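(* Let $G_1$ and $G_2$ be finite simple graphs on disjoint nonempty vertex sets. If $\operatorname{reg}(J_{G_i})\leq c(G_i)+1$ for $i=1,2$, then $\operatorname{reg}(J_{G_1*G_2})\leq c(G_1*G_2)+1$.
   Context: Let $\mathbb{K}$ be a field. For a finite simple graph $G$ on a finite totally ordered vertex set $V$ with edge set $E$, the binomial edge ideal of $G$ is the ideal $J_G=(x_iy_j-x_jy_i : i<j,\ \{i,j\}\in E)$ of $\mathbb{K}[x_i,y_i : i\in V]$. $c(G)$ denotes the number of maximal cliques (maximal with respect to inclusion) of $G$. The join $G_1*G_2$ of two graphs with disjoint vertex sets $V_1,V_2$ and edge sets $E_1,E_2$ is the graph with vertex set $V_1\cup V_2$ and edge set $E_1\cup E_2\cup\{\{v,w\} : v\in V_1,\ w\in V_2\}$. $\operatorname{reg}$ denotes Castelnuovo–Mumford regularity of a graded ideal (standard grading), with the convention that $\operatorname{reg}$ of the zero ideal is $-\infty$. *)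

(* Defs.v *)
From HB Require Import structures.
From mathcomp Require Import all_boot all_order all_algebra.
From mathcomp Require Import mpoly.
From mathcomp Require Import boolp classical_sets constructive_ereal.

Set Implicit Arguments.
Unset Strict Implicit.
Unset Printing Implicit Defensive.

Import Order.TTheory GRing.Theory Num.Theory.

Local Open Scope ring_scope.

Record sgraph (V : finType) := SGraph {
  adj :> rel V;
  adj_sym : ssrbool.symmetric adj;
  adj_irr : irreflexive adj }.

Section Graphs.
Variable V : finType.
Implicit Types (G : sgraph V) (A : {set V}).

Definition clique G A : bool :=
  [forall v in A, forall w in A, (v != w) ==> adj G v w].

Definition num_max_cliques G : nat := #|[set A : {set V} | maxset (clique G) A]|.

End Graphs.

Section Join.
Variables (V1 V2 : finType) (G1 : sgraph V1) (G2 : sgraph V2).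

(* The sum type V1 + V2 is the union of the disjoint sets V1 and V2. *)
Definition join_adj : rel (V1 + V2)%type := fun v w =>
  match v, w with
  | inl v1, inl w1 => adj G1 v1 w1
  | inr v2, inr w2 => adj G2 v2 w2
  | _, _ => true
  end.

Lemma join_adj_sym : ssrbool.symmetric join_adj.
Proof. by case=> v [] w //=; rewrite adj_sym. Qed.

Lemma join_adj_irr : irreflexive join_adj.
Proof. by case=> v /=; rewrite adj_irr. Qed.

Definition graph_join : sgraph (V1 + V2)%type :=
  SGraph join_adj_sym join_adj_irr.

End Join.

Section Regularity.
Variables (K : fieldType) (n : nat).
Local Notation S := {mpoly K[n]}.

Definition ideal_gen (I : finType) (P : pred I) (g : I -> S) : set S :=
  [set p | exists c : I -> S, p = \sum_(i | P i) c i * g i]%classic.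

(* A minimal graded free resolution of the ideal I, with the conventions
   F_i = \bigoplus_(k < res_rank i) S(- res_shift i k), elements of F_i being
   row vectors and maps acting by right multiplication:
     ... -> F_2 -(res_diff 1)-> F_1 -(res_diff 0)-> F_0 -(res_aug)-> I -> 0.
   The maps are homogeneous of degree 0, so a nonzero entry (k, l) of
   res_diff i is homogeneous of degree res_shift i.+1 k - res_shift i l.
   Minimality says that all entries of the differentials lie in the ideal
   generated by the variables.  Shifts can be taken in nat because I lives in
   nonnegative degrees. *)
Record min_graded_free_res (I : set S) := MinGradedFreeRes {
  res_rank : nat -> nat;
  res_shift : forall i, 'I_(res_rank i) -> nat;
  res_aug : 'cV[S]_(res_rank 0);
  res_diff : forall i, 'M[S]_(res_rank i.+1, res_rank i);
  res_aug_homog : forall k, res_aug k 0 \is (res_shift k).-homog;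
  res_diff_homog : forall i k l,
    {in msupp (res_diff i k l), forall m,
       (mdeg m + res_shift l = res_shift k)%N};
  res_aug_im : forall p : S,
    I p <-> exists u : 'rV_(res_rank 0), (u *m res_aug) 0 0 = p;
  res_exact0 : forall u : 'rV_(res_rank 0),
    u *m res_aug = 0 <-> exists v, u = v *m res_diff 0;
  res_exactS : forall i (u : 'rV_(res_rank i.+1)),
    u *m res_diff i = 0 <-> exists v, u = v *m res_diff i.+1;
  res_minimal : forall i k l, (res_diff i k l)@_0%MM = 0 }.

Definition betti (I : set S) (F : min_graded_free_res I) (i j : nat) : nat :=
  #|[set k : 'I_(res_rank F i) | res_shift k == j]|.

(* reg I = sup {j - i | beta_(i,j)(I) != 0}, with sup set0 = -oo.  Minimal
   graded free resolutions being isomorphic, the choice of F is immaterial. *)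
Definition reg (I : set S) : \bar int :=
  supremum -oo%E
    [set x | exists i j (F : min_graded_free_res I),
       betti F i j != 0%N /\ x = (j%:Z - i%:Z)%:E]%classic.

End Regularity.

Section BinomialEdgeIdeal.
Variables (K : fieldType) (V : finType).

Definition total_order (le : rel V) : Prop :=
  [/\ reflexive le, antisymmetric le, transitive le & total le].

Definition xvar (v : V) : {mpoly K[#|V| + #|V|]} :=
  'X_(lshift #|V| (enum_rank v)).
Definition yvar (v : V) : {mpoly K[#|V| + #|V|]} :=
  'X_(rshift #|V| (enum_rank v)).

Definition binomial_edge_ideal (le : rel V) (G : sgraph V) :
    set {mpoly K[#|V| + #|V|]} :=
  ideal_gen (fun e : V * V => [&& e.1 != e.2, le e.1 e.2 & adj G e.1 e.2])
    (fun e => xvar e.1 * yvar e.2 - xvar e.2 * yvar e.1).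

End BinomialEdgeIdeal.

Arguments xvar K {V} v.
Arguments yvar K {V} v.
Arguments binomial_edge_ideal K {V} le G.

(* Main.v *)
From HB Require Import structures.
Require Import Defs.
From mathcomp Require Import all_boot all_order all_algebra.
From mathcomp Require Import mpoly zify ring.
From mathcomp Require Import boolp classical_sets constructive_ereal.

(** Let P, P_1, P_2 be the ideals of all 2-minors of the generic 2-row matrices
    on V_1 + V_2, V_1 and V_2, and J, J_1, J_2 the edge ideals of G_1 * G_2, G_1
    and G_2.  A Pluecker relation shows that a variable of one side times a
    minor of the other side lies in J, so P/J is the direct sum of P_1/J_1 and
    P_2/J_2, where the variables of the other side act as zero.  As
    reg P_i <= 2, this gives reg J <= max (3, reg J_1, reg J_2), which is enough
    unless G_1 * G_2 has a single maximal clique; then it is complete, J = P and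
    reg J <= 2.

    Long exact sequences are handled by Koszul homology, built one operator at a
    time.  The bound reg P <= 2 is by induction on the number of columns: x_k is
    a nonzerodivisor modulo P, and modulo x_k the ideal of minors of the other
    columns, enlarged by y_k, differs from P by a shifted quotient of the ring by
    variables.  Koszul homology and minimal resolutions bound each other by
    dimension shifting; a minimal resolution exists by Dickson's lemma. *)

Set Implicit Arguments.
Unset Strict Implicit.
Unset Printing Implicit Defensive.

Import Order.TTheory GRing.Theory Num.Theory.

(** * Koszul complexes *)
Section Koszul.
Local Open Scope ring_scope.
Variables (I : Type) (R : comNzRingType) (W : lmodType R) (a : I -> R).
Implicit Types (l : seq I) (M N L : nat -> W -> Prop).

(** The regularity is a supremum over minimal resolutions, so a bound on it carries information only
    once a resolution exists: exploiting the hypotheses on [G_1] and [G_2] requires constructing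
    one. The comparison of [J] with [J_1] and [J_2] also crosses rings. Koszul homology is therefore
    taken with respect to labels acting through [a], where operators may vanish or be repeated; one
    list of labels then serves all the rings. Graded subquotients are pairs of families of
    predicates indexed by the degree, so no quotient is ever formed. The constant 3 arises from
    [reg P_i <= 2]: the quotient [P_i/J_i] has regularity at most the maximum of 2 and
    [reg J_i - 1], and passing from [P/J] back to [J] costs one more. *)

Fixpoint kos l : lmodType R :=
  if l is _ :: l' then (kos l' * kos l')%type : lmodType R else W.

(** An iterated mapping cone: the second component holds the coefficients of the terms containing
    [e_x], and the sign makes the square vanish. All exterior degrees live in one module; the degree
    that is tracked is that of the coefficients, which the differential raises by one. *)
Fixpoint kd l : kos l -> kos l :=
  if l is x :: l' then fun c : kos l' * kos l' => (kd c.1 + a x *: c.2, - kd c.2)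
  else fun=> 0.

Fixpoint kall (P : W -> Prop) l : kos l -> Prop :=
  if l is x :: l' then fun c : kos l' * kos l' => kall P c.1 /\ kall P c.2
  else P.

(* [kfil p c]: the chain [c] lives in exterior degrees < p. *)
Fixpoint kfil (p : nat) l : kos l -> Prop :=
  if l is x :: l' then fun c : kos l' * kos l' => kfil p c.1 /\ kfil p.-1 c.2
  else fun w => p = 0%N -> w = 0.

Fixpoint kemb l : W -> kos l :=
  if l is x :: l' then fun w => (kemb l' w, 0) else id.

(** Homogeneous pieces are not stable under all scalars, so a graded module is a family of subgroups
    that each operator maps one degree up. *)
Definition gsub M :=
  [/\ forall d, M d 0, forall d u v, M d u -> M d v -> M d (u - v)
    & forall d x u, M d u -> M d.+1 (a x *: u)].

Definition ksub (P : W -> Prop) := P 0 /\ forall u v, P u -> P v -> P (u - v).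

(* [kreg l M N r]: the graded module M/N has vanishing Koszul homology with
   respect to the operators [a x], x in l, in all internal degrees > r; the
   degree [d] is that of the coefficients, so this says reg (M/N) <= r. *)
Definition kreg l M N (r : nat) := forall d, (r <= d)%N ->
  forall c : kos l, kall (M d.+1) c -> kall (N d.+2) (kd c) ->
  exists b, kall (M d) b /\ kall (N d.+1) (c - kd b).

Lemma kos_subE x l (u v : kos (x :: l)) : u - v = (u.1 - v.1 : kos l, u.2 - v.2 : kos l).
Proof. by []. Qed.

Lemma kos_scaleE x l r (u : kos (x :: l)) : r *: u = (r *: u.1 : kos l, r *: u.2 : kos l).
Proof. by []. Qed.

Lemma kdE x l (u : kos (x :: l)) : kd u = (kd u.1 + a x *: u.2 : kos l, - kd u.2 : kos l).
Proof. by []. Qed.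

Lemma kdB l : {morph @kd l : u v / u - v}.
Proof.
elim: l => [|x l IH] u v; first by rewrite /= subr0.
rewrite kos_subE !kdE kos_subE !IH scalerBr opprB; congr pair.
  by rewrite addrACA -opprD.
by rewrite addrC opprK.
Qed.

Lemma kd0 l : kd (0 : kos l) = 0.
Proof. by rewrite -[X in kd X](subrr 0) kdB subrr. Qed.
Lemma kdN l u : kd (- u : kos l) = - kd u.
Proof. by rewrite -sub0r kdB kd0 sub0r. Qed.
Lemma kdD l (u v : kos l) : kd (u + v) = kd u + kd v.
Proof. by rewrite -{1}(opprK v) kdB kdN opprK. Qed.

Lemma kdZ l r (u : kos l) : kd (r *: u) = r *: kd u.
Proof.
elim: l u => [|x l IH] u; first by rewrite /= scaler0.
rewrite kos_scaleE !kdE kos_scaleE !IH -scalerN; congr pair.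
by rewrite scalerDr !scalerA mulrC.
Qed.

Lemma kdd l (c : kos l) : kd (kd c) = 0.
Proof.
elim: l c => [//|x l IH] u; rewrite !kdE; congr pair; last by rewrite kdN IH oppr0 oppr0.
by rewrite kdD kdZ IH add0r scalerN subrr.
Qed.

Lemma kall0 P l : P 0 -> kall P (0 : kos l).
Proof. by move=> P0; elim: l => //= x l IH. Qed.

Lemma kallB P l (u v : kos l) : ksub P -> kall P u -> kall P v -> kall P (u - v).
Proof.
case=> _ PB; elim: l u v => [|x l IH] /= u v; first exact: PB.
by case=> [? ?] [? ?]; split; apply: IH.
Qed.

Lemma kallN P l (u : kos l) : ksub P -> kall P u -> kall P (- u).
Proof. by move=> sP Pu; rewrite -sub0r; apply: kallB => //; apply: kall0; case: sP. Qed.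

Lemma kallD P l (u v : kos l) : ksub P -> kall P u -> kall P v -> kall P (u + v).
Proof. by move=> sP Pu Pv; rewrite -(opprK v); apply: kallB => //; apply: kallN. Qed.

Lemma kall_imp (P Q : W -> Prop) l (c : kos l) :
  (forall w, P w -> Q w) -> kall P c -> kall Q c.
Proof. by move=> PQ; elim: l c => [|x l IH] /= c; [apply: PQ|case=> ? ?; split; apply: IH]. Qed.

Lemma kallZ (P Q : W -> Prop) r l (c : kos l) :
  (forall w, P w -> Q (r *: w)) -> kall P c -> kall Q (r *: c).
Proof. by move=> PQ; elim: l c => [|x l IH] /= c; [apply: PQ|case=> ? ?; split; apply: IH]. Qed.

Lemma kall_eq0 l (c : kos l) : kall (fun w => w = 0) c -> c = 0.
Proof.
by elim: l c => [|x l IH] //= [u v] /= [/IH -> /IH ->].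
Qed.

Lemma gsub_ksub M d : gsub M -> ksub (M d).
Proof. by case=> M0 MB _; split; [apply: M0|apply: MB]. Qed.

Lemma gsub0 : gsub (fun _ w => w = 0).
Proof. by split=> // [_ u v -> ->|_ x u ->]; rewrite ?subrr ?scaler0. Qed.

Lemma gsubZ M d x u : gsub M -> M d u -> M d.+1 (a x *: u).
Proof. by case=> _ _; apply. Qed.

Lemma kall_kd M d l (c : kos l) : gsub M -> kall (M d) c -> kall (M d.+1) (kd c).
Proof.
move=> gM; elim: l c => [|x l IH] c; first by move=> _; case: gM => M0 _ _; apply: M0.
case: c => c1 c2 [Mc1 Mc2]; rewrite kdE; have sM := gsub_ksub d.+1 gM.
split; last by apply: kallN => //; apply: IH.
by apply: kallD => //; [apply: IH|apply: kallZ Mc2 => w; apply: gsubZ].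
Qed.

Lemma kreg_le l M N r s : (r <= s)%N -> kreg l M N r -> kreg l M N s.
Proof. by move=> rs H d sd; apply: H; apply: leq_trans sd. Qed.

Lemma kreg_shift l M N r :
  kreg l (fun d => M d.+1) (fun d => N d.+1) r -> kreg l M N r.+1.
Proof. by move=> H [//|d] /H. Qed.

Lemma kreg_ext l M N M' N' r :
  (forall d w, M d w <-> M' d w) -> (forall d w, N d w <-> N' d w) ->
  kreg l M N r -> kreg l M' N' r.
Proof.
move=> MM NN H d rd c Mc Nc.
have [||b [Mb Nb]] := H d rd c; [by apply: kall_imp Mc => w /MM
  |by apply: kall_imp Nc => w /NN|].
by exists b; split; [apply: kall_imp Mb => w /MM|apply: kall_imp Nb => w /NN].
Qed.

(** The long exact sequence of the cone of [a x], on chains modulo [N]: if [b] bounds [v], then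
    [u + a x *: b] is a cycle for [l], and a bound [b'] of it gives the bound [(b', - b)] of
    [(u, v)]. *)
Lemma kreg_add_op x l M N r : gsub M -> gsub N -> kreg l M N r -> kreg (x :: l) M N r.
Proof.
move=> gM gN H d rd [u v] [Mu Mv] [N1 N2].
have sN k := gsub_ksub k gN.
have sM k := gsub_ksub k gM.
have [|b [Mb Nb]] := H d rd v Mv; first by rewrite -(opprK (kd v)); apply: kallN.
have [||b' [Mb' Nb']] := H d rd (u + a x *: b).
- by apply: kallD => //; apply: kallZ Mb => w; apply: gsubZ.
- rewrite kdD kdZ.
  have -> : kd u + a x *: kd b = (kd u + a x *: v) - a x *: (v - kd b).
    by rewrite scalerBr opprB -addrA (addrC (a x *: v)) subrK.
  by apply: kallB => //; apply: kallZ Nb => w; apply: gsubZ.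
exists (b', - b); split; first by split => //=; apply: kallN.
rewrite kdE kos_subE; split; last by rewrite kdN opprK.
by rewrite scalerN opprD opprK addrA addrAC.
Qed.

(* The internal degree-d part of N + (a x) M. *)
Definition addN x M N d w := exists n m,
  [/\ N d n, (if d is e.+1 then M e m else m = 0) & w = n + a x *: m].

Lemma kall_addN x M N d l (c : kos l) : kall (addN x M N d.+1) c ->
  exists n m, [/\ kall (N d.+1) n, kall (M d) m & c = n + a x *: m].
Proof.
elim: l c => [|y l IH] c; first by case=> n [m [? ? ->]]; exists n, m.
case: c => u v /= [/IH [n [m [Nn Mm ->]]] /IH [n' [m' [Nn' Mm' ->]]]].
by exists (n, n'), (m, m').
Qed.

Lemma addN_kall x M N d l (w v : kos l) : gsub M ->
  kall (N d.+1) (w + a x *: v) -> kall (M d) v -> kall (addN x M N d.+1) w.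
Proof.
move=> gM; elim: l w v => [|y l IH] w v.
  move=> Nw Mv; exists (w + a x *: v), (- v); split=> //.
    by rewrite -sub0r; case: gM => M0 MB _; apply: MB.
  by rewrite scalerN addrK.
case: w v => w1 w2 [v1 v2] [/= N1 N2] [/= M1 M2].
by split; [apply: IH M1|apply: IH M2].
Qed.

(** The cone of an injective map has the homology of its cokernel, so an operator that is a
    nonzerodivisor on M/N can be traded for a smaller quotient. *)
Lemma kreg_nzd x l M N r : gsub M -> gsub N ->
  (forall d w, M d w -> N d.+1 (a x *: w) -> N d w) ->
  kreg l M (addN x M N) r -> kreg (x :: l) M N r.
Proof.
move=> gM gN nzd H d rd [u v] [Mu Mv] [N1 N2].
have sN k := gsub_ksub k gN.
have sM k := gsub_ksub k gM.
have nzdk k (w : kos l) : kall (M k) w -> kall (N k.+1) (a x *: w) -> kall (N k) w.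
  elim: (l) w => [|y l' IH] w; first exact: nzd.
  by case: w => w1 w2 [? ?] [? ?]; split; apply: IH.
rewrite /= in N1 N2.
(* Bounding [u] modulo [a x] leaves a remainder [a x *: m]; injectivity then forces [v] to agree
   with [- kd m] modulo [N], so [(b, m)] is the bound. *)
have [|b [Mb /kall_addN [n [m [Nn Mm Eu]]]]] := H d rd u Mu.
  exact: addN_kall Mv.
exists (b, m); split=> //; rewrite kdE kos_subE.
have Nb : kall (N d.+1) (v + kd m).
  apply: nzdk; first by apply: kallD => //; apply: kall_kd.
  have -> : a x *: (v + kd m) = (kd u + a x *: v) - kd n.
    have -> : u = kd b + n + a x *: m by rewrite -addrA -Eu addrC subrK.
    by rewrite scalerDr -kdZ !kdD kdd add0r -[X in _ = X - _]addrA [RHS]addrC addKr addrC.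
  by apply: kallB => //; apply: kall_kd.
split=> /=; last by rewrite opprK.
have -> : u - (kd b + a x *: m) = n by rewrite opprD addrA Eu addrK.
by [].
Qed.

Lemma kreg_trans l M N L r : gsub M ->
  (forall d w, N d w -> M d w) -> (forall d w, L d w -> N d w) ->
  kreg l M N r -> kreg l N L r -> kreg l M L r.
Proof.
move=> gM NM LN H1 H2 d rd c Mc Lc.
have [|b [Mb Nb]] := H1 d rd c Mc; first by apply: kall_imp Lc; apply: LN.
have [|b' [Nb' Lb']] := H2 d rd _ Nb; first by rewrite kdB kdd subr0.
exists (b + b'); rewrite kdD opprD addrA; split => //.
by apply: kallD => //; [apply: gsub_ksub|apply: kall_imp Nb'; apply: NM].
Qed.

(** In the long exact sequence of N/L, M/L and M/N, a class of N/L that dies in M/L comes from M/N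
    through the connecting map, from one exterior degree higher and with coefficients of one degree
    less. This is why [r] turns into [r.+1]. *)
Lemma kreg_sub l M N L r : gsub M -> gsub N -> (forall d w, N d w -> M d w) ->
  (forall d w, L d w -> N d w) ->
  kreg l M N r -> kreg l M L r.+1 -> kreg l N L r.+1.
Proof.
move=> gM gN NM LN H1 H2 d rd c Nc Lc.
have [|b [Mb Lb]] := H2 d rd c _ Lc; first by apply: kall_imp Nc; apply: NM.
case: d rd c Nc Lc b Mb Lb => [//|d] rd c Nc Lc b Mb Lb.
have [|e [Me Ne]] := H1 d rd b Mb.
  have -> : kd b = c - (c - kd b) by rewrite opprB addrC subrK.
  apply: kallB => //; first exact: gsub_ksub.
  by apply: kall_imp Lb; apply: LN.
by exists (b - kd e); rewrite kdB kdd subr0.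
Qed.

(* [kreg] in one degree [d], on chains of exterior degree < p. *)
Definition kex p l M N d := forall c : kos l, kfil p c ->
  kall (M d.+1) c -> kall (N d.+2) (kd c) ->
  exists b, kall (M d) b /\ kall (N d.+1) (c - kd b).

Lemma kfil_ge p l (c : kos l) : (size l < p)%N -> kfil p c.
Proof.
elim: l p c => [|x l IH] [|p] c //= sp; case: c => c1 c2; split; apply: IH => //.
exact: ltnW.
Qed.

Lemma kreg_kex l M N r : (forall p d, (r <= d)%N -> kex p l M N d) -> kreg l M N r.
Proof. by move=> H d rd c; apply: (H (size l).+1) => //; apply: kfil_ge. Qed.

Lemma kfil0 l (c : kos l) : kfil 0 c -> c = 0.
Proof. by elim: l c => [|x l IH] c; [apply|case: c => u v /= [/IH -> /IH ->]]. Qed.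

Lemma kfil_0 p l : kfil p (0 : kos l).
Proof. by elim: l p => [|x l IH] p //=. Qed.

Lemma kfilB p l (u v : kos l) : kfil p u -> kfil p v -> kfil p (u - v).
Proof.
elim: l p u v => [|x l IH] p u v.
  by move=> /= Hu Hv p0; rewrite Hu ?Hv ?subrr.
by case: u v => [u1 u2] [v1 v2] [? ?] [? ?]; split; apply: IH.
Qed.

Lemma kfilZ p l r (u : kos l) : kfil p u -> kfil p (r *: u).
Proof.
elim: l p u => [|x l IH] p u; first by move=> /= Hu p0; rewrite Hu ?scaler0.
by case: u => [u1 u2] [? ?]; split; apply: IH.
Qed.

Lemma kfil_kd p l (u : kos l) : kfil p u -> kfil p.-1 (kd u).
Proof.
elim: l p u => [|x l IH] p u //; case: u => [u1 u2] [Hu1 Hu2]; rewrite kdE /=.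
split; last by rewrite -[- _]sub0r; apply: kfilB; [apply: kfil_0|apply: IH].
by rewrite -[_ + _]opprK opprD -[- (_ - _)]sub0r; apply: kfilB; rewrite ?opprD;
  [apply: kfil_0|rewrite -[- kd u1]sub0r; apply: kfilB; [apply: kfilB;[apply: kfil_0|apply: IH]|apply: kfilZ]].
Qed.

Lemma kex0 l M N d : gsub M -> gsub N -> kex 0 l M N d.
Proof.
move=> gM gN c /kfil0 -> _ _; exists 0; rewrite kd0 subr0.
by split; apply: kall0; [case: gM|case: gN].
Qed.

(** The connecting map from M/N to N/L lowers the exterior degree by one and raises the degree of
    the coefficients by one. Recording the exterior degree lets an induction along a resolution of
    unknown length stop. *)
Lemma kex_quot p l M N L d : gsub M -> gsub N -> gsub L ->
  (forall d w, N d w -> M d w) -> (forall d w, L d w -> N d w) ->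
  (forall c : kos l, kall (M d.+1) c -> kall (L d.+2) (kd c) ->
     exists b, kall (M d) b /\ kall (L d.+1) (c - kd b)) ->
  kex p l N L d.+1 -> kex p.+1 l M N d.
Proof.
move=> gM gN gL NM LN H1 H2 c /kfil_kd /= fc Mc Nc.
have [|w [Nw Lw]] := H2 _ fc Nc; first by rewrite kdd; apply: kall0; case: gL.
have [||b [Mb Lb]] := H1 (c - w).
- by apply: kallB => //; [apply: gsub_ksub|apply: kall_imp Nw; apply: NM].
- by rewrite kdB.
exists b; split=> //; have -> : c - kd b = w + (c - w - kd b).
  by rewrite (addrAC c) [RHS]addrC subrK.
by apply: kallD; [apply: gsub_ksub| |apply: kall_imp Lb; apply: LN].
Qed.

Lemma kreg_quot l M N L r : gsub M -> gsub N -> gsub L ->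
  (forall d w, N d w -> M d w) -> (forall d w, L d w -> N d w) ->
  kreg l M L r -> kreg l N L r.+1 -> kreg l M N r.
Proof.
move=> gM gN gL NM LN H1 H2; apply: kreg_kex => -[|p] d rd; first exact: kex0.
apply: kex_quot gL NM LN _ _ => //; first exact: H1.
by move=> c _; apply: H2.
Qed.

Fixpoint kfst l : kos l -> W :=
  if l is x :: l' then fun c : kos l' * kos l' => kfst c.1 else id.

Lemma kfstD l (u v : kos l) : kfst (u + v) = kfst u + kfst v.
Proof. by elim: l u v => //= x l IH u v; rewrite IH. Qed.

Lemma kfstZ l r (u : kos l) : kfst (r *: u) = r *: kfst u.
Proof. by elim: l u => //= x l IH u; rewrite IH. Qed.

Lemma kfst_kd l P (Y : W -> Prop) (b : kos l) : ksub Y ->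
  (forall x u, P u -> Y (a x *: u)) -> kall P b -> Y (kfst (kd b)).
Proof.
move=> [Y0 YB] YP; elim: l b => [|x l IH] b; first by [].
move: b => [b1 b2] [/= P1 P2].
rewrite kfstD kfstZ -[X in Y (_ + X)]opprK; apply: (YB); first exact: IH.
rewrite -sub0r; apply: YB => //; apply: YP.
by elim: (l) (b2) P2 => [|y l' IH'] b' //=; case: b' => ? ? [/IH'].
Qed.

(** Vanishing in exterior degree 0 says that [M d.+1] is spanned by the images of [M d] under the
    operators. [Y] is any subgroup containing these images, so the span itself is never built. *)
Lemma kreg_gen l M r (Y : W -> Prop) d w : kreg l M (fun _ u => u = 0) r ->
  (r <= d)%N -> gsub M -> ksub Y -> (forall x u, M d u -> Y (a x *: u)) ->
  M d.+1 w -> Y w.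
Proof.
move=> H rd gM sY YM Mw.
have dw l' : kd (kemb l' w) = 0.
  by elim: l' => // x l' IH; rewrite kdE /= IH scaler0 add0r (kd0 l') oppr0.
have Me l' : kall (M d.+1) (kemb l' w).
  by elim: l' => // x l' IH; split=> //; apply: kall0; case: gM.
have Ew l' : kfst (kemb l' w) = w by elim: l'.
have [|b [Mb /kall_eq0 /subr0_eq Eb]] := H d rd _ (Me l); first by rewrite dw; apply: kall0.
by rewrite -(Ew l) Eb; apply: kfst_kd Mb.
Qed.

End Koszul.

(** * Transport of Koszul homology along morphisms *)

Section KoszulMorphism.
Local Open Scope ring_scope.
Variables (I : Type) (R R' : comNzRingType) (W : lmodType R) (W' : lmodType R').
Variables (a : I -> R) (a' : I -> R') (f : W -> W').
Hypothesis fB : {morph f : u v / u - v}.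
Hypothesis fa : forall x w, f (a x *: w) = a' x *: f w.
Implicit Types (l : seq I).

Fixpoint kmap l : kos W l -> kos W' l :=
  if l is x :: l' then fun c : kos W l' * kos W l' => (kmap c.1, kmap c.2) else f.

Lemma kmap_kd l (c : kos W l) : kmap (kd a c) = kd a' (kmap c).
Proof.
have f0 : f 0 = 0 by rewrite -[X in f X](subrr 0) fB subrr.
have kB k : {morph @kmap k : u v / u - v}.
  by elim: k => [|x k IH] u v //=; rewrite !IH.
have k0 k : kmap (0 : kos W k) = 0 by rewrite -[X in kmap X](subrr 0) kB subrr.
have kN k u : kmap (- u : kos W k) = - kmap u by rewrite -sub0r kB k0 sub0r.
have kD k (u v : kos W k) : kmap (u + v) = kmap u + kmap v.
  by rewrite -{1}(opprK v) kB kN opprK.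
have kZ k x (u : kos W k) : kmap (a x *: u) = a' x *: kmap u.
  by elim: k u => [|y k IH] u //=; rewrite !IH.
elim: l c => [|x l IH] c /=; first exact: f0.
by rewrite kD kN kZ !IH.
Qed.

Lemma kmapB l : {morph @kmap l : u v / u - v}.
Proof. by elim: l => [|x k IH] u v //=; rewrite !IH. Qed.

Lemma kall_kmap (P : W -> Prop) (P' : W' -> Prop) l (c : kos W l) :
  (forall w, P w -> P' (f w)) -> kall P c -> kall P' (kmap c).
Proof.
move=> PP; elim: l c => [|x l IH] c; first exact: PP.
by case: c => c1 c2 [? ?]; split; apply: IH.
Qed.

Variables (M N : nat -> W -> Prop) (M' N' : nat -> W' -> Prop).
Hypotheses (gM : gsub a M) (gN : gsub a N) (gM' : gsub a' M') (gN' : gsub a' N').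
(* [f] induces an isomorphism M/N -> M'/N' of graded modules. *)
Hypothesis fM : forall d w, M d w -> M' d (f w).
Hypothesis fN : forall d w, N d w -> N' d (f w).
Hypothesis f_inj : forall d w, M d w -> N' d (f w) -> N d w.
Hypothesis f_surj : forall d w', M' d w' -> exists w, M d w /\ N' d (w' - f w).

Lemma kall_inj d l (c : kos W l) : kall (M d) c -> kall (N' d) (kmap c) -> kall (N d) c.
Proof.
elim: l c => [|x l IH] c; first exact: f_inj.
by case: c => c1 c2 [? ?] [? ?]; split; apply: IH.
Qed.

(** Coefficients are lifted one by one; where the filtration forces a coefficient to be zero, its
    lift is zero, so exterior degrees are preserved. *)
Lemma kmap_lift d p l (c' : kos W' l) : kfil p c' -> kall (M' d) c' ->
  exists c : kos W l, [/\ kfil p c, kall (M d) c & kall (N' d) (c' - kmap c)].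
Proof.
have f0 : f 0 = 0 by rewrite -[X in f X](subrr 0) fB subrr.
elim: l p c' => [|x l IH] p c'.
  case: p => [|p] /= c0 Mc; last by have [w [? ?]] := f_surj Mc; exists w.
  by exists 0; rewrite c0 // f0 subrr; case: gM gN' => ? _ _ [? _ _].
case: c' => u v [/IH Hu /IH Hv] [/Hu [u' [? ? ?]] /Hv [v' [? ? ?]]].
by exists (u', v').
Qed.

Lemma kex_push p l d : kex a p l M N d -> kex a' p l M' N' d.
Proof.
move=> H c' fc Mc Nc.
have sN k := gsub_ksub k gN'; have sM k := gsub_ksub k gM'.
have [c [fc' Mc' Nc']] := kmap_lift fc Mc.
have [|b [Mb Nb]] := H c fc' Mc'.
  apply: kall_inj; first exact: kall_kd.
  rewrite kmap_kd; have -> : kd a' (kmap c) = kd a' c' - kd a' (c' - kmap c).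
    by rewrite kdB opprB addrC subrK.
  by apply: kallB => //; apply: kall_kd.
exists (kmap b); split; first by apply: kall_kmap Mb; apply: fM.
have -> : c' - kd a' (kmap b) = (c' - kmap c) + kmap (c - kd a b).
  by rewrite kmapB kmap_kd addrA subrK.
by apply: kallD => //; apply: kall_kmap Nb; apply: fN.
Qed.

Lemma kreg_push l r : kreg a l M N r -> kreg a' l M' N' r.
Proof.
by move=> H; apply: kreg_kex => p d rd; apply: kex_push => c _; apply: H.
Qed.

Lemma kreg_pull l r : kreg a' l M' N' r -> kreg a l M N r.
Proof.
move=> H d rd c Mc Nc; have sN k := gsub_ksub k gN'.
have [||b' [Mb Nb]] := H d rd (kmap c).
- by apply: kall_kmap Mc; apply: fM.
- by rewrite -kmap_kd; apply: kall_kmap Nc; apply: fN.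
have [b [_ Mb' Nb']] := kmap_lift (kfil_ge b' (ltnSn _)) Mb.
exists b; split=> //; apply: kall_inj.
  by apply: kallB => //; [apply: gsub_ksub gM|apply: kall_kd gM Mb'].
have -> : kmap (c - kd a b) = (kmap c - kd a' b') + kd a' (b' - kmap b).
  by rewrite kdB addrA subrK kmapB kmap_kd.
by apply: kallD => //; apply: kall_kd.
Qed.
End KoszulMorphism.

(** * Supports of polynomials *)
Section MonomialSupport.
Local Open Scope ring_scope.
Variables (K : fieldType) (n : nat).
Local Notation S := {mpoly K[n]}.
Implicit Types (P Q T : pred 'X_{1..n}) (p q : S) (m : 'X_{1..n}) (B : pred 'I_n).

(** Homogeneity, divisibility by a variable and membership in an ideal generated by variables are
    all conditions on the support, so their closure properties are proved once. *)
Definition msup P p := forall m, p@_m != 0 -> P m.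

Lemma msup0 P : msup P 0.
Proof. by move=> m; rewrite mcoeff0 eqxx. Qed.

Lemma msupB P p q : msup P p -> msup P q -> msup P (p - q).
Proof.
move=> Pp Pq m; rewrite mcoeffB; case: (eqVneq p@_m 0) => [->|/Pp //].
by rewrite sub0r oppr_eq0 => /Pq.
Qed.

Lemma msupN P p : msup P p -> msup P (- p).
Proof. by move=> Pp; rewrite -sub0r; apply: msupB => //; apply: msup0. Qed.

Lemma msupD P p q : msup P p -> msup P q -> msup P (p + q).
Proof. by move=> Pp Pq; rewrite -(opprK q); apply: msupB => //; apply: msupN. Qed.

Lemma msupZ P c p : msup P p -> msup P (c *: p).
Proof.
by move=> Pp m; rewrite mcoeffZ mulf_eq0 negb_or => /andP [_ /Pp].
Qed.

Lemma msup_sum P J (r : seq J) (D : pred J) (F : J -> S) :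
  (forall j, D j -> msup P (F j)) -> msup P (\sum_(j <- r | D j) F j).
Proof. by move=> H; elim/big_ind: _ => //; [apply: msup0|apply: msupD]. Qed.

Lemma msupX P m : P m -> msup P 'X_[m].
Proof. by move=> Pm m'; rewrite mcoeffX; case: (m =P m') => [<- //|_ /eqP []]. Qed.

Lemma msup_imp P Q p : (forall m, P m -> Q m) -> msup P p -> msup Q p.
Proof. by move=> PQ H m /H /PQ. Qed.

Lemma msupM P Q T p q : (forall m m', P m -> Q m' -> T (m + m')%MM) ->
  msup P p -> msup Q q -> msup T (p * q).
Proof.
move=> PQ Hp Hq m; rewrite -mcoeff_msupp => /msuppM_le /allpairsP [[m1 m2] /=].
by rewrite !mcoeff_msupp => -[/Hp P1 /Hq Q2 ->]; apply: PQ.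
Qed.

Lemma msup_homog d p : msup (fun m => mdeg m == d) p <-> p \is d.-homog.
Proof.
split=> [H|/dhomogP H m].
  by apply/dhomogP => m; rewrite mcoeff_msupp => /H /eqP.
by rewrite -mcoeff_msupp => /H /eqP.
Qed.

Definition mfilter P p : S := \sum_(m <- msupp p | P m) p@_m *: 'X_[m].

Lemma mcoeff_mfilter P p m : (mfilter P p)@_m = if P m then p@_m else 0.
Proof.
rewrite /mfilter raddf_sum /=.
under eq_bigr do rewrite mcoeffZ mcoeffX.
case: ifP => Pm; last first.
  rewrite big1 // => m' Pm'; case: eqP => [E|_]; last by rewrite mulr0.
  by rewrite E Pm in Pm'.
case: (boolP (m \in msupp p)) => [pm|npm].
  rewrite big_mkcond (bigD1_seq m) //= Pm eqxx mulr1 big1 ?addr0 // => m' /negbTE ->.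
  by rewrite mulr0 if_same.
rewrite (memN_msupp_eq0 npm) big_seq_cond big1 // => m' /andP [pm' _].
by case: eqP => [E|_]; rewrite ?mulr0 //; rewrite -E pm' in npm.
Qed.

Lemma mfilterB P : {morph mfilter P : p q / p - q}.
Proof.
move=> p q; apply/mpolyP => m; rewrite mcoeffB !mcoeff_mfilter mcoeffB.
by case: (P m); rewrite ?subrr.
Qed.

Lemma mfilterD P : {morph mfilter P : p q / p + q}.
Proof.
move=> p q; apply/mpolyP => m; rewrite mcoeffD !mcoeff_mfilter mcoeffD.
by case: (P m); rewrite ?addr0.
Qed.

Lemma mfilter0 P : mfilter P 0 = 0.
Proof. by rewrite -[X in mfilter P X](subrr 0) mfilterB subrr. Qed.

Lemma mfilter_sum P J (r : seq J) (D : pred J) (F : J -> S) :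
  mfilter P (\sum_(j <- r | D j) F j) = \sum_(j <- r | D j) mfilter P (F j).
Proof. by apply: (big_morph (mfilter P)); [apply: mfilterD|apply: mfilter0]. Qed.

Lemma msup_mfilter P p : msup P (mfilter P p).
Proof. by move=> m; rewrite mcoeff_mfilter; case: ifP => //; rewrite eqxx. Qed.

Lemma msup_mfilterW P Q p : msup Q p -> msup Q (mfilter P p).
Proof. by move=> H m; rewrite mcoeff_mfilter; case: ifP => [_ /H|]; rewrite ?eqxx. Qed.

Lemma mfilter_id P p : msup P p -> mfilter P p = p.
Proof.
move=> H; apply/mpolyP => m; rewrite mcoeff_mfilter; case: ifP => // /negbT Pm.
by case: (eqVneq p@_m 0) => // /H; rewrite (negbTE Pm).
Qed.

Lemma mfilter_eq0 P p : msup (fun m => ~~ P m) p -> mfilter P p = 0.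
Proof.
move=> H; apply/mpolyP => m; rewrite mcoeff_mfilter mcoeff0; case: ifP => // Pm.
by case: (eqVneq p@_m 0) => // /H; rewrite Pm.
Qed.

Lemma mfilterC P p : p = mfilter P p + mfilter (fun m => ~~ P m) p.
Proof.
by apply/mpolyP => m; rewrite mcoeffD !mcoeff_mfilter; case: (P m); rewrite ?addr0 ?add0r.
Qed.

(** For [q] homogeneous this says that multiplication by [q] commutes with taking homogeneous
    components, up to a shift of the degree. *)
Lemma mfilterM P Q T p q : msup T q ->
  (forall m m', T m' -> P (m + m')%MM = Q m) -> mfilter P (p * q) = mfilter Q p * q.
Proof.
move=> Tq PQ; rewrite {1}(mfilterC Q p) mulrDl mfilterD.
have H1 : msup P (mfilter Q p * q).
  by apply: (msupM _ (@msup_mfilter Q p) Tq) => m m' Qm Tm; rewrite (PQ _ _ Tm).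
have H2 : msup (fun m => ~~ P m) (mfilter (fun m => ~~ Q m) p * q).
  by apply: (msupM _ (@msup_mfilter (fun m => ~~ Q m) p) Tq) => m m' Qm Tm; rewrite (PQ _ _ Tm).
by rewrite (mfilter_id H1) (mfilter_eq0 H2) addr0.
Qed.

Lemma mdivX i p : msup (fun m => m i != 0%N) p ->
  exists q, p = 'X_i * q /\ forall P, msup P p -> msup (fun m => P (U_(i) + m)%MM) q.
Proof.
move=> H; exists (\sum_(m <- msupp p) p@_m *: 'X_[m - U_(i)]); split.
  rewrite {1}[p]mpolyE mulr_sumr big_seq [RHS]big_seq; apply: eq_bigr => m.
  rewrite mcoeff_msupp => /H Hm; rewrite -scalerAr -mpolyXD addmC submK //.
  by rewrite lep1mP.
move=> P Pp; rewrite big_seq; apply: msup_sum => m; rewrite mcoeff_msupp => pm.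
rewrite -mul_mpolyC; apply: (@msupM (fun m => m == 0%MM) (fun m' => m' == (m - U_(i))%MM)).
- move=> m1 m2 /eqP -> /eqP ->; rewrite add0m addmC submK ?lep1mP; [exact: Pp|exact: H].
- by move=> m'; rewrite mcoeffC; case: (m' =P 0%MM) => // _; rewrite mulr0 eqxx.
- by apply: msupX.
Qed.

(* The ideal generated by the variables in B. *)
Definition var_ideal B : S -> Prop := msup (fun m => [exists i, B i && (m i != 0%N)]).

Lemma var_idealM B p q : var_ideal B q -> var_ideal B (p * q).
Proof.
apply: (@msupM predT) => // m m' _ /existsP [i /andP [Bi mi]].
by apply/existsP; exists i; rewrite Bi mnmDE addn_eq0 negb_and mi orbT.
Qed.

Lemma var_idealX B i : B i -> var_ideal B 'X_i.
Proof. by move=> Bi; apply: msupX; apply/existsP; exists i; rewrite Bi mnm1E eqxx. Qed.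

Lemma var_ideal_nzd B i p : ~~ B i -> var_ideal B ('X_i * p) -> var_ideal B p.
Proof.
move=> Bi H m pm; have /H /existsP [j /andP [Bj]] : ('X_i * p)@_(U_(i) + m) != 0.
  by rewrite mulrC mcoeffMX.
rewrite mnmDE mnm1E; case: (i =P j) => [E|_ mj]; first by rewrite E Bj in Bi.
by apply/existsP; exists j; rewrite Bj.
Qed.

Lemma mcoeff0M p q : (p * q)@_0%MM = p@_0%MM * q@_0%MM.
Proof. by rewrite (rmorphM (mcoeff 0%MM)). Qed.

End MonomialSupport.

Arguments msup_mfilter {K n} P p.

(** * Koszul homology of free modules and of quotients by variables *)

Section KoszulFree.
Local Open Scope ring_scope.
Variables (K : fieldType) (n : nat) (I : eqType).
Local Notation S := {mpoly K[n]}.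
Variable a : I -> S.
Hypothesis a_var : forall x, a x = 0 \/ exists i, a x = 'X_i.
Implicit Types (l : seq I) (B : pred 'I_n) (p q : S) (J : S -> Prop).

(* The shift s corresponds to the free module S(-s). *)
Definition hshift s d p := msup (fun m => mdeg m + s == d)%N p.

Lemma hshiftM s e q d p : hshift s e q -> hshift 0 d p -> hshift s (e + d) (q * p).
Proof.
apply: msupM => m m' /eqP <- /eqP <-.
by rewrite mdegD addn0 addnAC.
Qed.

Lemma hshiftX m : hshift 0 (mdeg m) 'X_[m].
Proof. by apply: msupX; rewrite addn0. Qed.

Definition ideal J := [/\ J 0, forall p q, J p -> J q -> J (p - q) &
  forall p q, J q -> J (p * q)].

Lemma idealD J p q : ideal J -> J p -> J q -> J (p + q).
Proof.
move=> [J0 JB _] Jp Jq; rewrite -(opprK q); apply: (JB) => //.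
by rewrite -sub0r; apply: (JB).
Qed.

Lemma ideal_sum J T (r : seq T) (D : pred T) (F : T -> S) : ideal J ->
  (forall j, D j -> J (F j)) -> J (\sum_(j <- r | D j) F j).
Proof.
move=> iJ H; elim/big_ind: _ => //; first by case: iJ.
by move=> ? ?; apply: idealD.
Qed.

Definition hpart J d (w : S^o) := J w /\ hshift 0 d w.

Lemma hshift_mulX s d x p : hshift s d p -> hshift s d.+1 (a x * p).
Proof.
case: (a_var x) => [->|[i ->]] H; first by rewrite mul0r; apply: msup0.
apply: (@msupM _ _ (pred1 U_(i)%MM)) (msupX _) H; rewrite ?inE ?eqxx //.
by move=> m m' /eqP -> /eqP <-; rewrite mdegD mdeg1.
Qed.

Lemma gsub_hshift s : gsub a (hshift s : nat -> S^o -> Prop).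
Proof.
split=> [d|d u v|d x u]; [exact: msup0|exact: msupB|exact: hshift_mulX].
Qed.

Lemma gsub_hpart J : ideal J -> gsub a (hpart J).
Proof.
move=> [J0 JB JM]; split=> [d|d u v [? ?] [? ?]|d x u [? ?]].
- by split=> //; apply: msup0.
- by split; [apply: JB|apply: msupB].
- by split; [apply: JM|apply: hshift_mulX].
Qed.

Lemma ideal_var B : ideal (var_ideal B).
Proof.
by split=> [|p q|p q]; [exact: msup0|exact: msupB|exact: var_idealM].
Qed.

(** Induction on [l]: an operator that is zero or a variable of [B] is added by [kreg_add_op]; any
    other variable is a nonzerodivisor and joins [B]. When no operator is left, [B] contains every
    variable and the quotient is the field, concentrated in degree 0. *)
Lemma kreg_var_ideal l B : (forall i, B i \/ exists2 x, x \in l & a x = 'X_i) ->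
  kreg a l (hshift 0 : nat -> S^o -> Prop) (hpart (var_ideal B)) 0.
Proof.
elim: l B => [|x l IH] B cov.
  move=> d _ c Mc _; exists 0; split; first exact: msup0.
  rewrite subr0; split=> // m /Mc; rewrite addn0 => /eqP dm.
  case: (boolP (m == 0%MM)) => [/eqP m0|]; first by rewrite m0 mdeg0 in dm.
  move=> m0; apply/existsP; apply: contrapT => H; case/eqP: m0; apply/mnmP => i.
  rewrite mnm0E; apply: contrapT => /eqP mi; case: H; exists i; rewrite mi andbT.
  by case: (cov i) => // -[].
have gM := gsub_hshift 0; have gN := gsub_hpart (ideal_var B).
have [ax|[i ax]] := a_var x.
  apply: kreg_add_op => //; apply: IH => i; case: (cov i); [by left|case=> y].
  rewrite inE => /orP [/eqP ->|yl ay]; last by right; exists y.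
  rewrite ax => /mpolyP /(_ U_(i)%MM); rewrite mcoeff0 mcoeffX eqxx => /eqP.
  by rewrite eq_sym oner_eq0.
case: (boolP (B i)) => Bi.
  apply: kreg_add_op => //; apply: IH => j; case: (cov j); [by left|case=> y].
  rewrite inE => /orP [/eqP ->|yl ay]; last by right; exists y.
  rewrite ax => /mpolyP /(_ U_(i)%MM); rewrite !mcoeffX eqxx.
  by case: eqP => [/eqP|_ /eqP]; rewrite ?oner_eq0 // eq_mnm1 => /eqP -> _; left.
apply: kreg_nzd => //.
  move=> d w hw [Bw _]; split=> //; apply: var_ideal_nzd Bi _.
  by rewrite -ax.
apply: kreg_ext (IH (predU1 i B) _) => // [d w|j]; last first.
  case: (cov j) => [H|[y]]; first by left; rewrite /= H orbT.
  rewrite inE => /orP [/eqP ->|yl ay]; last by right; exists y.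
  rewrite ax => /mpolyP /(_ U_(i)%MM); rewrite !mcoeffX eqxx.
  by case: eqP => [/eqP|_ /eqP]; rewrite ?oner_eq0 // eq_mnm1 => /eqP -> _; left; rewrite /= eqxx.
split=> [[Bw hw]|[u [v [[Bu hu] hv ->]]]]; last first.
  split; last first.
    apply: msupD => //; case: d hv {hu} => [->|e hv]; first by rewrite scaler0; apply: msup0.
    exact: hshift_mulX.
  apply: msupD.
    apply: msup_imp Bu => m /existsP [j /andP [Bj mj]]; apply/existsP; exists j.
    by rewrite /= Bj orbT.
  rewrite /GRing.scale /= mulrC; apply: var_idealM; rewrite ax; apply: var_idealX.
  by rewrite /= eqxx.
have [q [Eq Hq]] := mdivX (msup_mfilter (fun m => m i != 0%N) w).
exists (mfilter (fun m => m i == 0%N) w), q; split.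
- split; last exact: msup_mfilterW.
  move=> m; rewrite mcoeff_mfilter; case: ifP; rewrite ?eqxx // => mi /Bw.
  move=> /existsP [j /andP [/= /orP [/eqP ->|Bj] mj]]; first by rewrite mi in mj.
  by apply/existsP; exists j; rewrite Bj.
- have {}Hq := Hq _ (msup_mfilterW hw).
  case: d hw Hq => [|d] _ Hq; last first.
    by apply: msup_imp Hq => m; rewrite mdegD mdeg1.
  by apply/mpolyP => m; rewrite mcoeff0; case: (eqVneq q@_m 0) => // /Hq; rewrite mdegD mdeg1.
- rewrite /GRing.scale /= ax -Eq {1}(mfilterC (fun m => m i == 0%N) w) //.
Qed.

Lemma kreg_hshift l s : (forall i, exists2 x, x \in l & a x = 'X_i) ->
  kreg a l (hshift s : nat -> S^o -> Prop) (fun _ w => w = 0) s.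
Proof.
move=> cov; elim: s => [|s IH].
  apply: kreg_ext (kreg_var_ideal (B := pred0) _) => // [d w|i]; last by right.
  split=> [[H _]|->]; last by split; apply: msup0.
  apply/mpolyP => m; rewrite mcoeff0; case: (eqVneq w@_m 0) => // /H /existsP [i].
  by rewrite andFb.
apply: kreg_shift; apply: kreg_ext IH => // d w.
by split; apply: msup_imp => m; rewrite addnS eqSS.
Qed.

Section Free.
Variables (m : nat) (s : 'I_m -> nat).
Definition hrow d (u : 'rV[S]_m) := forall k, hshift (s k) d (u 0 k).

Lemma gsub_hrow : gsub a hrow.
Proof.
split=> [d k|d u v Hu Hv k|d x u Hu k].
- by rewrite mxE; apply: msup0.
- by rewrite !mxE; apply: msupB (Hu k) (Hv k).
- by rewrite mxE; exact: hshift_mulX (Hu k).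
Qed.

(** Rows whose first [j] entries vanish filter the free module; projecting to the next entry
    identifies each successive quotient with a shifted copy of the ring. *)
Lemma kreg_hrow l r : (forall i, exists2 x, x \in l & a x = 'X_i) ->
  (forall k, (s k <= r)%N) -> kreg a l hrow (fun _ w => w = 0) r.
Proof.
move=> cov sr; pose F j d u := hrow d u /\ forall k : 'I_m, (k < j)%N -> u 0 k = 0.
have gF j : gsub a (F j).
  have [H0 HB HZ] := gsub_hrow.
  split=> [d|d u v [? u0] [? v0]|d x u [? u0]].
  - by split=> // k _; rewrite mxE.
  - by split; [apply: HB|move=> k kj; rewrite !mxE u0 ?v0 ?subrr].
  - by split; [apply: HZ|move=> k kj; rewrite mxE u0 ?mulr0].
suff: kreg a l (F 0%N) (fun _ w => w = 0) r.
  by apply: kreg_ext => // d u; split=> [[]|].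
have main j : (j <= m)%N -> kreg a l (F (m - j)%N) (fun _ w => w = 0) r.
  elim: j => [|j IH] jm.
    apply: (kreg_ext (M := fun _ w => w = 0) (N := fun _ w => w = 0)) => // [d u|].
      split=> [->|[_ Hu]]; first by case: (gF (m - 0)%N).
      by apply/rowP => k; rewrite mxE Hu // subn0.
    by move=> d _ c /kall_eq0 -> _; exists 0; rewrite kd0 subr0; split; apply: kall0.
  have Ej : (m - j = (m - j.+1).+1)%N by lia.
  have {}IH := IH (ltnW jm); rewrite Ej in IH.
  have kj : (m - j.+1 < m)%N by lia.
  apply: kreg_trans (gF _) _ _ _ IH.
  - by move=> d u [Hu u0]; split=> // k kj'; apply: u0; lia.
  - by move=> d u ->; case: (gF (m - j.+1).+1).
  pose k0 := Ordinal kj.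
  refine (@kreg_pull I S S 'rV[S]_m S^o a a (fun u => u 0 k0) _ _ _ _ (hshift (s k0))
    (fun _ w => w = 0) (gF _) (gsub0 _ a) _ _ _ _ l r (kreg_le (sr k0) (kreg_hshift cov))).
  - by move=> u v; rewrite !mxE.
  - by move=> x u; rewrite !mxE.
  - by move=> d u [Hu _]; apply: Hu.
  - by move=> d u [_]; apply.
  - move=> d u [Hu u0] uk; split=> // k; rewrite ltnS leq_eqVlt => /orP [/eqP kE|]; last exact: u0.
    by have -> : k = k0 by apply: val_inj.
  - move=> d w hw; exists (\row_k if k == k0 then w else 0).
    split; last by rewrite mxE eqxx subrr.
    split=> k; first by rewrite mxE; case: eqP => [->|_] //; apply: msup0.
    by rewrite mxE => kk; case: eqP => // kE; rewrite kE ltnn in kk.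
by have := main m (leqnn m); rewrite subnn.
Qed.
End Free.
End KoszulFree.

Section AddN.
Local Open Scope ring_scope.
Variables (I : Type) (R : comNzRingType) (W : lmodType R) (a : I -> R).

Lemma gsub_addN x (M N : nat -> W -> Prop) : gsub a M -> gsub a N -> gsub a (addN a x M N).
Proof.
move=> [M0 MB MZ] [N0 NB NZ]; split.
- move=> d; exists 0, 0; split; rewrite ?scaler0 ?addr0 //.
  by case: d => [//|d]; apply: M0.
- move=> d u v [n [m [Nn Mm ->]]] [n' [m' [Nn' Mm' ->]]].
  exists (n - n'), (m - m'); split; first exact: NB.
    by case: d Mm Mm' {Nn Nn'} => [-> ->|d Mm Mm']; rewrite ?subrr //; apply: MB.
  by rewrite scalerBr opprD addrACA.
- move=> d y u [n [m [Nn Mm ->]]]; exists (a y *: n), (a y *: m); split.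
  + exact: NZ.
  + by case: d Mm {Nn} => [->|d Mm]; [rewrite scaler0; apply: M0|apply: MZ].
  + by rewrite scalerDr !scalerA mulrC.
Qed.

Lemma gsub_shift (M : nat -> W -> Prop) : gsub a M -> gsub a (fun d => M d.+1).
Proof. by move=> [M0 MB MZ]; split=> *; [apply: M0|apply: MB|apply: MZ]. Qed.
End AddN.

(** * Ring homomorphisms given by monomials *)

Section MonomialMap.
Local Open Scope ring_scope.
Variables (K : fieldType) (n n' : nat) (k : 'I_n -> 'X_{1..n'}).

Definition mnm_map (m : 'X_{1..n}) : 'X_{1..n'} := (\sum_i k i *+ m i)%MM.

Lemma mnm_mapE m j : mnm_map m j = (\sum_i k i j * m i)%N.
Proof. by rewrite mnm_sumE; apply: eq_bigr => i _; rewrite mulmnE. Qed.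

Lemma mnm_mapD m m' : mnm_map (m + m') = (mnm_map m + mnm_map m')%MM.
Proof.
apply/mnmP => j; rewrite mnmDE !mnm_mapE -big_split /=.
by apply: eq_bigr => i _; rewrite mnmDE mulnDr.
Qed.

Lemma mnm_map1 i : mnm_map U_(i) = k i.
Proof.
apply/mnmP => j; rewrite mnm_mapE (bigD1 i) //= mnm1E eqxx muln1 big1 ?addn0 // => i' ii'.
by rewrite mnm1E eq_sym (negbTE ii') muln0.
Qed.

Definition monomial_map : {mpoly K[n]} -> {mpoly K[n']} :=
  comp_mpoly [tuple 'X_[k i] | i < n].
HB.instance Definition _ := GRing.RMorphism.on monomial_map.

Lemma monomial_mapX m : monomial_map 'X_[m] = 'X_[mnm_map m].
Proof.
rewrite /monomial_map comp_mpolyX -mprodXE; apply: eq_bigr => i _.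
by rewrite tnth_mktuple mpolyXn.
Qed.

Lemma mcoeff_monomial_map p mu :
  (monomial_map p)@_mu = \sum_(m <- msupp p | mnm_map m == mu) p@_m.
Proof.
rewrite {1}[p]mpolyE (raddf_sum monomial_map) raddf_sum [RHS]big_mkcond /=; apply: eq_bigr => m _.
rewrite /monomial_map comp_mpolyZ -/monomial_map mcoeffZ.
rewrite -/(monomial_map _) monomial_mapX mcoeffX.
by case: eqP; rewrite ?mulr1 ?mulr0.
Qed.
End MonomialMap.

(** * Generic 2-minors *)
Section GenericMinors.
Local Open Scope ring_scope.
Variables (K : fieldType) (N : nat).
Local Notation S := {mpoly K[N + N]}.
Implicit Types (A : seq 'I_N) (p q : S).

Definition xi (i : 'I_N) : 'I_(N + N) := lshift N i.
Definition yi (i : 'I_N) : 'I_(N + N) := rshift N i.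

(* x_i |-> z_i and y_i |-> t z_i: the kernel is the ideal of 2-minors. *)
Definition segre (j : 'I_(N + N)) : 'X_{1..N + 1} :=
  match split j with
  | inl i => U_(lshift 1 i)%MM
  | inr i => (U_(lshift 1 i) + U_(rshift N ord0))%MM
  end.

Lemma segre_x i : segre (xi i) = U_(lshift 1 i)%MM.
Proof. by rewrite /segre; have /= -> := unsplitK (inl i : 'I_N + 'I_N). Qed.
Lemma segre_y i : segre (yi i) = (U_(lshift 1 i) + U_(rshift N ord0))%MM.
Proof. by rewrite /segre; have /= -> := unsplitK (inr i : 'I_N + 'I_N). Qed.

Local Notation ka := (mnm_map segre).

Lemma ka_z m i : ka m (lshift 1 i) = (m (xi i) + m (yi i))%N.
Proof.
rewrite mnm_mapE big_split_ord /= (bigD1 i) //= big1 ?addn0; last first.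
  by move=> j ji; rewrite segre_x mnm1E (inj_eq (@lshift_inj _ _)) (negbTE ji).
rewrite segre_x mnm1E eqxx mul1n; congr addn.
rewrite (bigD1 i) //= big1 ?addn0; last first.
  move=> j ji; rewrite segre_y mnmDE !mnm1E (inj_eq (@lshift_inj _ _)) (negbTE ji).
  by rewrite eq_rlshift.
by rewrite segre_y mnmDE !mnm1E eqxx eq_rlshift mul1n.
Qed.

Lemma ka_t m : ka m (rshift N ord0) = (\sum_i m (yi i))%N.
Proof.
rewrite mnm_mapE big_split_ord /= big1 ?add0n; last first.
  by move=> j _; rewrite segre_x mnm1E eq_lrshift.
apply: eq_bigr => i _; rewrite segre_y mnmDE !mnm1E eq_lrshift eqxx.
by rewrite mul1n.
Qed.

Lemma mdeg_ka m : mdeg m = (\sum_i ka m (lshift 1 i))%N.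
Proof.
rewrite mdegE big_split_ord /= -big_split /=.
by apply: eq_bigr => i _; rewrite ka_z.
Qed.

Section Fibres.
Variable J : S -> Prop.
Hypothesis iJ : ideal J.
Hypothesis minorsJ : forall i j, J ('X_(xi i) * 'X_(yi j) - 'X_(xi j) * 'X_(yi i)).

(* Two monomials with the same image are either coprime, or have a common
   variable to cancel; a coprime pair gets one after exchanging a minor. *)
Lemma segre_fibre m m' : ka m = ka m' -> J ('X_[m] - 'X_[m']).
Proof.
have [J0 JB JM] := iJ.
have [d md] := ubnP (mdeg m); elim: d => [//|d IH] in m m' md * => E.
have dE : mdeg m = mdeg m' by rewrite !mdeg_ka E.
have common m1 m2 j : mdeg m1 = mdeg m -> ka m1 = ka m2 -> m1 j != 0%N -> m2 j != 0%N ->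
    J ('X_[m1] - 'X_[m2]).
  move=> dm1 E12 m1j m2j.
  have s1 : (U_(j) + (m1 - U_(j)))%MM = m1 by rewrite addmC submK ?lep1mP.
  have s2 : (U_(j) + (m2 - U_(j)))%MM = m2 by rewrite addmC submK ?lep1mP.
  rewrite -s1 -s2 !mpolyXD -mulrBr; apply: (JM); apply: (IH).
    by move: md; rewrite -dm1 -{1}s1 mdegD mdeg1.
  by move: E12; rewrite -{1}s1 -{1}s2 !mnm_mapD => /addmI.
have exchange m1 m2 i : mdeg m1 = mdeg m -> ka m1 = ka m2 -> m1 (xi i) != 0%N ->
    J ('X_[m1] - 'X_[m2]).
  move=> dm1 E12 m1i.
  case: (eqVneq (m2 (xi i)) 0%N) => [m2i|]; last exact: common.
  have m2y : m2 (yi i) != 0%N.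
    have := congr1 (fun m : 'X_{1..N + 1} => m (lshift 1 i)) E12.
    by rewrite /= !ka_z m2i; lia.
  case: (eqVneq (m1 (yi i)) 0%N) => [m1y|m1y]; last exact: common m1y m2y.
  (* The exponents of [t] agree and [m2] contains [y_i], so [m1] contains some [y_j]. *)
  have [j m1j] : exists j, m1 (yi j) != 0%N.
    have := congr1 (fun m : 'X_{1..N + 1} => m (rshift N ord0)) E12.
    rewrite /= !ka_t => Et; apply: contrapT => no.
    move: Et; rewrite big1 => [|j _]; last by apply: contrapT => /eqP h; case: no; exists j.
    by rewrite (bigD1 i) //=; lia.
  have ji : j != i by apply: contraNneq m1j => ->; rewrite m1y.
  pose r := (m1 - U_(xi i) - U_(yi j))%MM.
  have s1 : m1 = (U_(xi i) + U_(yi j) + r)%MM.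
    rewrite /r submDA addmC submK //; apply/mnm_lepP => v; rewrite mnmDE !mnm1E.
    case: eqP => [<-|_]; first by rewrite eq_rlshift addn0; lia.
    by case: eqP => [<-|_] //; lia.
  pose m3 := (U_(xi j) + U_(yi i) + r)%MM.
  have E13 : ka m1 = ka m3.
    by rewrite s1 /m3 !mnm_mapD !mnm_map1 !segre_x !segre_y; congr (_ + _)%MM;
       rewrite !addmA; congr (_ + _)%MM; rewrite addmC.
  have -> : 'X_[m1] - 'X_[m2] = ('X_[m1] - 'X_[m3]) + ('X_[m3] - 'X_[m2]) :> S.
    by rewrite addrA subrK.
  apply: idealD => //.
    rewrite {1}s1 /m3 !(mpolyXD K) -mulrBl mulrC; exact: JM.
  apply: (common _ _ (yi i)) => //; last by rewrite !mnmDE !mnm1E eqxx; lia.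
    by rewrite -dm1 !mdeg_ka E13.
  by rewrite -E13.
case: (boolP (m == 0%MM)) => [/eqP m0|m0].
  have -> : m' = 0%MM by apply/eqP; rewrite -mdeg_eq0 -dE m0 mdeg0.
  by rewrite m0 subrr.
have [j mj] : exists j, m j != 0%N.
  apply: contrapT => no; case/eqP: m0; apply/mnmP => j; rewrite mnm0E.
  by apply: contrapT => /eqP h; case: no; exists j.
case: (splitP j) => i ji; last first.
  have {}ji : j = yi i by apply: val_inj.
  rewrite {}ji in mj; case: (eqVneq (m (xi i)) 0%N) => [mi|]; last exact: exchange.
  have := congr1 (fun m : 'X_{1..N + 1} => m (lshift 1 i)) E.
  rewrite /= !ka_z mi; case: (eqVneq (m' (yi i)) 0%N) => [->|m'i _]; last exact: common mj m'i.
  move=> m'i; rewrite -opprB -sub0r; apply: (JB) => //; apply: (exchange _ _ i) => //.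
  by lia.
have {}ji : j = xi i by apply: val_inj.
by apply: (exchange _ _ i) => //; rewrite -ji.
Qed.

(** The coefficients of [p] sum to zero over each fibre. Hence replacing every monomial by a chosen
    representative [rho m] of its fibre turns [p] into 0, and [p] is a combination of the
    differences treated in [segre_fibre]. *)
Lemma segre_ker p : monomial_map (K := K) segre p = 0 -> J p.
Proof.
move=> p0; have [J0 JB JM] := iJ.
pose rho m := head m [seq m' <- msupp p | ka m' == ka m].
have rhoP m : m \in msupp p -> rho m \in msupp p /\ ka (rho m) = ka m.
  move=> pm; have : m \in [seq m' <- msupp p | ka m' == ka m] by rewrite mem_filter eqxx.
  rewrite /rho; case E: [seq _ <- _ | _] => [//|m1 s] _ /=.
  have : m1 \in [seq m' <- msupp p | ka m' == ka m] by rewrite E inE eqxx.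
  by rewrite mem_filter => /andP [/eqP].
have rhoE m m' : m \in msupp p -> ka m = ka m' -> rho m = rho m'.
  move=> pm E; rewrite /rho E; case E2: [seq _ <- _ | _] => [|//].
  have : m \in [seq m1 <- msupp p | ka m1 == ka m'] by rewrite mem_filter pm E eqxx.
  by rewrite E2.
have -> : p = \sum_(m <- msupp p) p@_m *: ('X_[m] - 'X_[rho m]).
  under eq_bigr do rewrite scalerBr.
  rewrite sumrB -mpolyE; have -> : \sum_(m <- msupp p) p@_m *: 'X_[rho m] = 0 :> S.
    apply/mpolyP => nu; rewrite mcoeff0 raddf_sum /=.
    under eq_bigr do rewrite mcoeffZ mcoeffX.
    case: (boolP (has (fun m => rho m == nu) (msupp p))) => [/hasP [m1 pm1 /eqP m1E]|no].
      apply: (@etrans _ _ (monomial_map (K := K) segre p)@_(ka m1)); last by rewrite p0 mcoeff0.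
      rewrite mcoeff_monomial_map [RHS]big_mkcond; apply: eq_big_seq => m pm /=.
      have -> : (rho m == nu) = (ka m == ka m1).
        apply/eqP/eqP => [E|E]; last by rewrite (rhoE _ _ pm E).
        by rewrite -(rhoP _ pm).2 E -m1E (rhoP _ pm1).2.
      by case: eqP; rewrite ?mulr1 ?mulr0.
    rewrite big_seq big1 // => m pm; case: eqP => E; last by rewrite mulr0.
    by case/hasP: no; exists m => //; apply/eqP.
  by rewrite subr0.
rewrite big_seq; apply: ideal_sum => // m pm; rewrite -mul_mpolyC; apply: (JM).
by apply: segre_fibre; rewrite (rhoP _ pm).2.
Qed.

End Fibres.

Local Notation phi := (monomial_map (K := K) segre).

(** Killing [z_i] kills the images of both [x_i] and [y_i], while [t] is always kept. The ideal of
    minors thus becomes the preimage of an ideal of variables, and whether [x_k] is a nonzerodivisor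
    can be read off [z_k]. *)
Definition out A (j : 'I_(N + 1)) := if split j is inl i then i \notin A else false.

Lemma out_z A i : out A (lshift 1 i) = (i \notin A).
Proof. by rewrite /out; have /= -> := unsplitK (inl i : 'I_N + 'I_1). Qed.

(* The ideal P_A + (x_i, y_i : i notin A), P_A being generated by the 2-minors
   with columns in A. *)
Definition minors A p := var_ideal (out A) (phi p).

Lemma ideal_minors A : ideal (minors A).
Proof.
have [V0 VB VM] := ideal_var K (out A); rewrite /minors.
by split=> [|p q Hp Hq|p q Hq]; rewrite ?rmorph0 ?rmorphB ?rmorphM //; auto.
Qed.

(** * Regularity of the ideals of minors *)

Section Regularity.
Variables (I : eqType) (a : I -> S) (lx ly : 'I_N -> I).
Hypothesis a_var : forall x, a x = 0 \/ exists i, a x = 'X_i.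
Hypothesis lxE : forall i, a (lx i) = 'X_(xi i).
Hypothesis lyE : forall i, a (ly i) = 'X_(yi i).

(** In each column [x_i] precedes [y_i], since the induction first divides by [x_k] and then meets
    [y_k]. *)
Definition labels A := flatten [seq [:: lx i; ly i] | i <- A].

Lemma mem_labels A i : i \in A -> lx i \in labels A /\ ly i \in labels A.
Proof.
by move=> iA; split; apply/flattenP; exists [:: lx i; ly i]; rewrite ?inE ?eqxx ?orbT //;
  apply: map_f.
Qed.

(** For [k] in [A], these variables generate the annihilator of [y_k] modulo [minors A] and
    [x_k]. *)
Definition not_y A (j : 'I_(N + N)) := if split j is inr i then i \notin A else true.

Lemma not_y_x A i : not_y A (xi i).
Proof. by rewrite /not_y; have /= -> := unsplitK (inl i : 'I_N + 'I_N). Qed.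
Lemma not_y_y A i : not_y A (yi i) = (i \notin A).
Proof. by rewrite /not_y; have /= -> := unsplitK (inr i : 'I_N + 'I_N). Qed.

(** A monomial in the [y_i] with [i] in [A] is alone in its fibre, because its [t]-exponent equals
    its degree and leaves no room for any [x_j]. Its coefficient therefore survives under [phi], at
    a monomial without any [z_i] outside [A]. *)
Lemma minors_not_y A p : minors A p -> var_ideal (not_y A) p.
Proof.
move=> Qp m pm; apply: contrapT => /negP; rewrite negb_exists => /forallP no.
have mx i : m (xi i) = 0%N by have := no (xi i); rewrite not_y_x negbK => /eqP.
have my i : i \notin A -> m (yi i) = 0%N.
  by move=> iA; have := no (yi i); rewrite not_y_y iA negbK => /eqP.
have : (phi p)@_(ka m) != 0.
  rewrite mcoeff_monomial_map big_mkcond (bigD1_seq m) /= ?msupp_uniq //; last first.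
    by rewrite mcoeff_msupp.
  rewrite eqxx big1 ?addr0 // => m' /negP m'm; case: eqP => // E; case: m'm.
  have Ez i : (m' (xi i) + m' (yi i))%N = m (yi i) by rewrite -ka_z E ka_z mx.
  have : (\sum_i m' (yi i) = \sum_i m (yi i))%N by rewrite -!ka_t E.
  under [RHS]eq_bigr do rewrite -Ez.
  rewrite big_split /= => /eqP; rewrite -[X in X == _]add0n eqn_add2r eq_sym sum_nat_eq0.
  move=> /forallP m'x; apply/eqP/mnmP => j; case: (splitP j) => i ji.
    have -> : j = xi i by apply: val_inj.
    by rewrite mx; apply/eqP; apply: m'x.
  have -> : j = yi i by apply: val_inj.
  by rewrite -Ez (eqP (m'x i)).
move=> /Qp /existsP [j]; rewrite /out; case: splitP => // i ji /andP [iA].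
have -> : j = lshift 1 i by apply: val_inj.
by rewrite ka_z mx my.
Qed.

Lemma minors_var A i : i \notin A -> minors A 'X_(xi i) /\ minors A 'X_(yi i).
Proof.
move=> iA; rewrite /minors !monomial_mapX !mnm_map1 segre_x segre_y; split.
  by apply: var_idealX; rewrite out_z.
by rewrite mpolyXD mulrC; apply: var_idealM; apply: var_idealX; rewrite out_z.
Qed.

Lemma minors_minor A i j : minors A ('X_(xi i) * 'X_(yi j) - 'X_(xi j) * 'X_(yi i)).
Proof.
rewrite /minors -!mpolyXD rmorphB /= !monomial_mapX !mnm_mapD !mnm_map1 !segre_x !segre_y.
have -> : (U_(lshift 1 i) + (U_(lshift 1 j) + U_(rshift N ord0)) =
  U_(lshift 1 j) + (U_(lshift 1 i) + U_(rshift N ord0)) :> 'X_{1..N + 1})%MM.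
  by rewrite !addmA (addmC U_(lshift 1 i)%MM).
by rewrite subrr; apply: msup0.
Qed.

Lemma minors_cons k A p : minors (k :: A) p -> minors A p.
Proof.
apply: msup_imp => m /existsP [j /andP [jA mj]]; apply/existsP; exists j.
rewrite mj andbT; move: jA; rewrite /out; case: splitP => // i _.
by rewrite inE negb_or => /andP [].
Qed.

Local Notation Sd := (hshift 0 : nat -> S^o -> Prop).

(** [r] collects the monomials of [p] free of [x_k] and [y_k]. It stays in [minors A], which
    contains both variables; as its image is free of [z_k], the killed variable dividing each
    monomial there has an index outside [k :: A]. *)
Lemma minors_split k A d p : minors A p -> hshift 0 d.+1 p -> k \notin A ->
  exists u v r, [/\ hshift 0 d u, hshift 0 d v, hshift 0 d.+1 r,
    minors (k :: A) r & p = 'X_(yi k) * u + ('X_(xi k) * v + r)].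
Proof.
move=> Qp hp kA; have [_ QB QM] := ideal_minors A.
have hdiv q i : hshift 0 d.+1 q -> msup (fun m => m i != 0%N) q ->
    exists u, q = 'X_i * u /\ hshift 0 d u.
  move=> hq /mdivX [u [E Hu]]; exists u; split=> //.
  by apply: msup_imp (Hu _ hq) => m; rewrite mdegD mdeg1.
pose p0 := mfilter (fun m => m (xi k) == 0%N) p.
pose r := mfilter (fun m => m (yi k) == 0%N) p0.
have [v [Ev hv]] : exists v, p - p0 = 'X_(xi k) * v /\ hshift 0 d v.
  have -> : p - p0 = mfilter (fun m => m (xi k) != 0%N) p.
    by rewrite {1}(mfilterC (fun m => m (xi k) == 0%N) p) addrC addKr.
  by apply: hdiv (msup_mfilter _ _); apply: msup_mfilterW.
have [u [Eu hu]] : exists u, p0 - r = 'X_(yi k) * u /\ hshift 0 d u.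
  have -> : p0 - r = mfilter (fun m => m (yi k) != 0%N) p0.
    by rewrite {1}(mfilterC (fun m => m (yi k) == 0%N) p0) addrC addKr.
  by apply: hdiv (msup_mfilter _ _); do 2![apply: msup_mfilterW].
exists u, v, r; split=> //; first by do 2![apply: msup_mfilterW].
  have [Qx Qy] := minors_var kA.
  have Qr : minors A r.
    have -> : r = p - v * 'X_(xi k) - u * 'X_(yi k).
      by rewrite [v * _]mulrC [u * _]mulrC -Ev -Eu; ring.
    by apply: (QB); [apply: (QB)|]; rewrite //; apply: QM.
  move=> mu rmu; have /existsP [j /andP [jA muj]] := Qr mu rmu.
  apply/existsP; exists j; rewrite muj andbT; move: jA muj; rewrite /out.
  case: splitP => // i ji iA; have -> : j = lshift 1 i by apply: val_inj.
  move=> mui; rewrite inE negb_or iA andbT; apply: contraNneq mui => ->.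
  move: rmu; rewrite mcoeff_monomial_map => rmu.
  have [m mr /eqP <-] : exists2 m, m \in msupp r & ka m == mu.
    apply: contrapT => no; case/eqP: rmu; rewrite big_seq_cond big1 // => m /andP [mr mmu].
    by case: no; exists m.
  rewrite mcoeff_msupp in mr; rewrite ka_z.
  have r_y : msup (fun m => m (yi k) == 0%N) r by apply: msup_mfilter.
  have r_x : msup (fun m => m (xi k) == 0%N) r by apply: msup_mfilterW; apply: msup_mfilter.
  by rewrite (eqP (r_y m mr)) (eqP (r_x m mr)).
by rewrite -Eu -Ev; ring.
Qed.

(** The bound is 1 because the new contribution at each column is a cyclic module generated by
    [y_k], of degree 1, whose annihilator is an ideal of variables. *)
Lemma kreg_minors A : uniq A -> kreg a (labels A) Sd (hpart (minors A)) 1.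
Proof.
elim: A => [|k A IH] /=.
  move=> _ d _ c hc _; exists 0; split; first exact: msup0.
  rewrite subr0; split=> // mu; rewrite mcoeff_monomial_map => cmu.
  have [m mr /eqP <-] : exists2 m, m \in msupp c & ka m == mu.
    apply: contrapT => no; case/eqP: cmu; rewrite big_seq_cond big1 // => m /andP [mr mmu].
    by case: no; exists m.
  rewrite mcoeff_msupp in mr; have := hc m mr; rewrite addn0 mdeg_ka => /eqP dm.
  have [i mi] : exists i, ka m (lshift 1 i) != 0%N.
    apply: contrapT => no; move: dm; rewrite big1 // => i _.
    by apply: contrapT => /eqP h; case: no; exists i.
  by apply/existsP; exists (lshift 1 i); rewrite out_z mi.
move=> /andP [kA uA]; have {}IH := IH uA.
have gS := gsub_hshift a_var 0.
have gQ B := gsub_hpart a_var (ideal_minors B).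
set A' := k :: A in gQ *.
(* [x_k] is sent to [z_k], which is not killed since [k] belongs to [A']. *)
apply: kreg_nzd => //.
  move=> d w hw [Qw _]; split=> //; apply: (@var_ideal_nzd _ _ (out A') (lshift 1 k)).
    by rewrite out_z inE eqxx.
  move: Qw; rewrite /minors lxE /GRing.scale /= rmorphM /= monomial_mapX mnm_map1.
  by rewrite segre_x.
set NN := addN _ _ _ _; have gN : gsub a NN by apply: gsub_addN.
apply: (@kreg_trans _ _ _ _ _ _ (hpart (minors A))) => //.
- by move=> d w [].
- move=> d w [n [v [[Qn hn] hv ->]]]; have [_ _ QM] := ideal_minors A.
  split; last first.
    apply: msupD => //; case: d hv {hn} => [->|d hv]; first by rewrite scaler0; apply: msup0.
    exact: (hshift_mulX a_var).
  apply: (idealD (ideal_minors A)); first exact: minors_cons Qn.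
  by rewrite /GRing.scale /= mulrC; apply: QM; rewrite lxE; case: (minors_var kA).
- exact: kreg_add_op.
have ayE (w : S^o) : a (ly k) *: w = 'X_(yi k) * w by rewrite lyE.
apply: kreg_shift.
have cov i : not_y A' i \/ exists2 x, x \in ly k :: labels A & a x = 'X_i.
  case: (splitP i) => j ij.
    by left; rewrite (_ : i = xi j); [apply: not_y_x|apply: val_inj].
  have -> : i = yi j by apply: val_inj.
  rewrite not_y_y; case: (boolP (j \in A')) => jA; last by left.
  right; exists (ly j); last exact: lyE.
  rewrite inE; move: jA; rewrite inE => /orP [/eqP ->|jA]; first by rewrite eqxx.
  by rewrite (mem_labels jA).2 orbT.
(* Multiplication by [y_k] identifies the quotient of the ring by the variables of [not_y A'] with
   [minors A] modulo [minors A'] and [x_k], one degree up. *)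
refine (@kreg_push I S S S^o S^o a a (fun w => 'X_(yi k) * w) _ _ Sd (hpart (var_ideal (not_y A')))
  (fun d => hpart (minors A) d.+1) (fun d => NN d.+1) gS _ _ _ _ _ _ _ _
  (kreg_var_ideal a_var cov)).
- by move=> u v; rewrite mulrBr.
- by move=> x w; rewrite /GRing.scale /= mulrCA.
- exact: gsub_shift (gQ A).
- exact: gsub_shift.
- move=> d w hw; split; last by rewrite -ayE; apply: (hshift_mulX a_var).
  by have [_ _ QM] := ideal_minors A; rewrite mulrC; apply: QM; case: (minors_var kA).
- move=> d w [Lw hw]; have sN := gsub_ksub d.+1 gN.
  rewrite [w]mpolyE big_seq mulr_sumr; elim/big_ind: _ => [|u v Nu Nv|m mw].
  + by case: sN.
  + rewrite -[v]opprK; have [N0 NB] := sN; apply: (NB) => //.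
    by rewrite -sub0r; apply: (NB).
  rewrite mcoeff_msupp in mw; have /existsP [j /andP [jB mj]] := Lw m mw.
  have Em : m = (U_(j) + (m - U_(j)))%MM by rewrite addmC submK ?lep1mP.
  set r := (m - U_(j))%MM in Em.
  have dr : (mdeg r).+1 = d.
    by move/eqP: (hw m mw); rewrite addn0 => <-; rewrite Em mdegD mdeg1.
  have hr q e : hshift 0 e q -> hshift 0 (e + mdeg r)%N (q * (w@_m *: 'X_[r])).
    by move=> hq; apply: (hshiftM hq); apply: msupZ; apply: hshiftX.
  have hX i : hshift (n := N + N) (K := K) 0 1 'X_i.
    by apply: msupX; rewrite mdeg1.
  have hX2 i i' : hshift (n := N + N) (K := K) 0 2 ('X_i * 'X_i') by apply: hshiftM.
  rewrite {2}Em mpolyXD scalerAr.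
  have [_ _ QM] := ideal_minors A'.
  have Qcase : minors A' 'X_j -> NN d.+1 ('X_(yi k) * ('X_j * (w@_m *: 'X_[r]))).
    move=> Qj; exists ('X_(yi k) * ('X_j * (w@_m *: 'X_[r]))), 0; split.
    - split; first by rewrite mulrCA mulrC; apply: (QM).
      have := hr _ _ (hX2 (yi k) j); rewrite -mulrA add2n dr; exact.
    - by case: gS.
    - by rewrite scaler0 addr0.
  move: jB Qcase; rewrite /not_y; case: splitP => i ji; last first.
    have -> : j = yi i by apply: val_inj.
    by move=> iA; apply; case: (minors_var iA).
  have -> : j = xi i by apply: val_inj.
  move=> _; case: (boolP (i \in A')) => iA; last by apply; case: (minors_var iA).
  (* [x_i y_k] is a minor with columns in [A'] plus the multiple [x_k y_i] of [x_k]. *)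
  move=> _; exists (('X_(xi i) * 'X_(yi k) - 'X_(xi k) * 'X_(yi i)) * (w@_m *: 'X_[r])),
    ('X_(yi i) * (w@_m *: 'X_[r])); split.
  + split; first by rewrite mulrC; apply: (QM); apply: minors_minor.
    by rewrite -[d]dr -add2n; apply: hr; exact: msupB (hX2 _ _) (hX2 _ _).
  + by rewrite -[d]dr -add1n; apply: hr.
  + by rewrite lxE /GRing.scale /=; ring.
(* Both [minors A'] and [x_k] lie in the ideal of the variables [not_y A'], modulo which [y_k] is a
   nonzerodivisor. *)
- move=> d w hw [n [v [[Qn hn] hv E]]]; split=> //.
  apply: (@var_ideal_nzd _ _ (not_y A') (yi k)); first by rewrite not_y_y inE eqxx.
  rewrite E; apply: msupD; first exact: minors_not_y.
  by rewrite /GRing.scale /= mulrC; apply: var_idealM; rewrite lxE; apply: var_idealX; apply: not_y_x.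
- move=> d w [Qw hw]; have [u [v [r [hu hv hr Qr E]]]] := minors_split Qw hw kA.
  exists u; split=> //; exists r, v; split=> //.
  by rewrite lxE E /GRing.scale /=; ring.
Qed.
End Regularity.
End GenericMinors.

(** * Minimal resolutions and Koszul homology *)
Section Resolution.
Local Open Scope ring_scope.
Variables (K : fieldType) (n : nat) (I : eqType).
Local Notation S := {mpoly K[n]}.
Variables (a : I -> S) (l : seq I).
Hypothesis a_var : forall x, a x = 0 \/ exists i, a x = 'X_i.
Hypothesis cov : forall i, exists2 x, x \in l & a x = 'X_i.

Definition homog_mx m' m (s' : 'I_m' -> nat) (s : 'I_m -> nat) (D : 'M[S]_(m', m)) :=
  forall k j, hshift (s j) (s' k) (D k j).

Definition hcomp m (s : 'I_m -> nat) d (u : 'rV[S]_m) : 'rV[S]_m :=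
  \row_k mfilter (fun mu => mdeg mu + s k == d)%N (u 0 k).

Lemma hrow_hcomp m (s : 'I_m -> nat) d u : hrow s d (hcomp s d u).
Proof. by move=> k; rewrite mxE; apply: msup_mfilter. Qed.

Lemma hcomp_id m (s : 'I_m -> nat) d u : hrow s d u -> hcomp s d u = u.
Proof. by move=> H; apply/rowP => k; rewrite mxE (mfilter_id (H k)). Qed.

Lemma hcomp_mulmx m' m (s' : 'I_m' -> nat) (s : 'I_m -> nat) (D : 'M_(m', m)) d v :
  homog_mx s' s D -> hcomp s d (v *m D) = hcomp s' d v *m D.
Proof.
move=> hD; apply/rowP => j; rewrite !mxE mfilter_sum; apply: eq_bigr => k _.
rewrite mxE; apply: (mfilterM (T := fun m2 => mdeg m2 + s j == s' k)%N); first exact: hD.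
by move=> m1 m2 /eqP <-; rewrite mdegD addnA.
Qed.

Lemma hrow_mulmx m' m (s' : 'I_m' -> nat) (s : 'I_m -> nat) (D : 'M_(m', m)) d v :
  homog_mx s' s D -> hrow s' d v -> hrow s d (v *m D).
Proof. by move=> hD hv; rewrite -(hcomp_id hv) -(hcomp_mulmx _ _ hD); apply: hrow_hcomp. Qed.

Section Step.
Variables (W : lmodType S) (Z : nat -> W -> Prop) (m : nat) (s : 'I_m -> nat).
Variable f : 'rV[S]_m -> W.
Hypothesis gZ : gsub a Z.
Hypothesis fB : {morph f : u v / u - v}.
Hypothesis fZ : forall r u, f (r *: u) = r *: f u.
Hypothesis fM : forall d u, hrow s d u -> Z d (f u).
Hypothesis f_surj : forall d w, Z d w -> exists2 u, hrow s d u & f u = w.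

Definition kerd d u := hrow s d u /\ f u = 0.

Lemma step_f0 : f 0 = 0.
Proof. by rewrite -[X in f X](subrr 0) fB subrr. Qed.

Lemma gsub_kerd : gsub a kerd.
Proof.
have [H0 HB HZ] := gsub_hrow a_var s.
split=> [d|d u v [hu u0] [hv v0]|d x u [hu u0]]; split; auto.
- exact: step_f0.
- by rewrite fB u0 v0 subrr.
- by rewrite fZ u0 scaler0.
Qed.

(** Dimension shifting: [kerd] is a submodule, with quotient [Z], of a free module of regularity at
    most [r]. *)
Lemma kreg_step r : (forall k, (s k <= r)%N) ->
  kreg a l Z (fun _ w => w = 0) r -> kreg a l kerd (fun _ w => w = 0) r.+1.
Proof.
move=> sr H; have gF := gsub_hrow a_var s.
apply: (@kreg_sub _ _ _ _ _ (hrow s)) => //; [exact: gsub_kerd|by move=> d u []| | |].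
- by move=> d u ->; case: gsub_kerd.
- refine (@kreg_pull I S S 'rV[S]_m W a a f fB (fun x => fZ (a x)) (hrow s) kerd Z
    (fun _ w => w = 0) gF (gsub0 _ a) fM _ _ _ l r H).
  + by move=> d w [].
  + by move=> d w hw fw.
  + by move=> d w /f_surj [u hu <-]; exists u; rewrite subrr.
- by apply: (kreg_hrow a_var cov) => k; apply: leqW.
Qed.

(** Nakayama in graded form: above degree [r], the image of a basis row [e] is also the image of a
    row [u] without constant terms, so [e - u] would be a relation with a unit among its constant
    terms. *)
Lemma shift_le_kreg r : (forall u, f u = 0 -> forall k, (u 0 k)@_0%MM = 0) ->
  kreg a l Z (fun _ w => w = 0) r -> forall k, (s k <= r)%N.
Proof.
move=> fmin H k; case: leqP => // rs.
case Es: (s k) rs => [//|d] rd.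
pose e : 'rV[S]_m := \row_j (j == k)%:R.
have he : hrow s d.+1 e.
  move=> j; rewrite mxE; case: eqP => [->|_]; last exact: msup0.
  by rewrite -mpolyX0; apply: msupX; rewrite mdeg0 Es.
pose Y w := exists u, f u = w /\ forall j, (u 0 j)@_0%MM = 0.
have [|x w Zw|u [Eu u0]] := kreg_gen (Y := Y) H rd gZ _ _ (fM he).
- split=> [|w w' [u [<- u0]] [u' [<- u0']]].
    by exists 0; split=> [|j]; [exact: step_f0|rewrite mxE mcoeff0].
  by exists (u - u'); split=> // j; rewrite !mxE mcoeffB u0 u0' subrr.
- have [u hu <-] := f_surj Zw; exists (a x *: u); split; first exact: fZ.
  move=> j; rewrite mxE mcoeff0M; case: (a_var x) => [->|[i ->]].
    by rewrite mcoeff0 mul0r.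
  by rewrite mcoeffX mnm1_eq0 mul0r.
have := fmin (e - u) _ k; rewrite fB Eu subrr => /(_ erefl).
rewrite !mxE eqxx mcoeffB u0 subr0 mcoeff1 eqxx => /eqP.
by rewrite oner_eq0.
Qed.

Lemma kex_step p d : (forall k, (s k <= d)%N) ->
  kex a p l kerd (fun _ w => w = 0) d.+1 -> kex a p.+1 l Z (fun _ w => w = 0) d.
Proof.
move=> sd H; have gF := gsub_hrow a_var s.
refine (@kex_push I S S 'rV[S]_m W a a f fB (fun x => fZ (a x)) (hrow s) kerd Z
    (fun _ w => w = 0) gF gZ (gsub0 _ a) fM _ _ _ p.+1 l d _).
- by move=> e w [].
- by move=> e w hw fw.
- by move=> e w /f_surj [u hu <-]; exists u; rewrite subrr.
apply: (@kex_quot _ _ _ _ _ _ _ _ (fun _ w => w = 0)) => //.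
- exact: gsub_kerd.
- exact: gsub0.
- by move=> e w [].
- by move=> e w ->; case: gsub_kerd.
by move=> c; apply: (kreg_hrow a_var cov sd).
Qed.
End Step.

Section Koszul_vs_resolution.
Variables (J : set S) (F : min_graded_free_res J).
Hypothesis iJ : ideal J.

Definition kerF i : 'rV[S]_(res_rank F i) -> Prop :=
  match i with
  | 0 => fun u => u *m res_aug F = 0
  | j.+1 => fun u => u *m res_diff F j = 0
  end.

Definition cycF i d u := hrow (@res_shift _ _ _ F i) d u /\ kerF u.

Lemma kerF_exact i u : @kerF i u <-> exists v, u = v *m res_diff F i.
Proof. by case: i u => [|i] u; [exact: res_exact0|exact: res_exactS]. Qed.

Lemma homog_res_diff i : homog_mx (@res_shift _ _ _ F i.+1) (@res_shift _ _ _ F i) (res_diff F i).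
Proof.
move=> k j mu; rewrite -mcoeff_msupp => H.
by apply/eqP; apply: (res_diff_homog H).
Qed.

Lemma homog_res_aug : homog_mx (@res_shift _ _ _ F 0) (fun _ => 0%N) (res_aug F).
Proof.
move=> k j; rewrite ord1 => mu; rewrite addn0.
by have /msup_homog := res_aug_homog k; apply.
Qed.

Definition augF (u : 'rV[S]_(res_rank F 0)) : S^o := (u *m res_aug F) 0 0.

Lemma kerF0E u : @kerF 0 u <-> augF u = 0.
Proof.
by split=> [/= E|E]; [rewrite /augF E mxE|apply/matrixP => i j; rewrite !ord1 [RHS]mxE].
Qed.

Lemma augFB : {morph augF : u v / u - v}.
Proof. by move=> u v; rewrite /augF mulmxBl !mxE. Qed.
Lemma augFZ r u : augF (r *: u) = r *: augF u.
Proof. by rewrite /augF -scalemxAl !mxE. Qed.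

Lemma augF_hrow d u : hrow (@res_shift _ _ _ F 0) d u -> hpart J d (augF u).
Proof.
move=> hu; split; first by apply/res_aug_im; exists u.
exact: hrow_mulmx homog_res_aug hu _.
Qed.

Lemma augF_surj d w : hpart J d w -> exists2 u, hrow (@res_shift _ _ _ F 0) d u & augF u = w.
Proof.
move=> [/(@res_aug_im _ _ _ F) [u <-] hw]; exists (hcomp (@res_shift _ _ _ F 0) d u).
  exact: hrow_hcomp.
rewrite /augF -(hcomp_mulmx _ _ homog_res_aug) [LHS]mxE; exact: (mfilter_id hw).
Qed.

Lemma gsub_cycF i : gsub a (cycF (i := i)).
Proof.
have [H0 HB HZ] := gsub_hrow a_var (@res_shift _ _ _ F i).
have kB u v : @kerF i u -> kerF v -> kerF (u - v).
  by move=> /kerF_exact [u' ->] /kerF_exact [v' ->]; apply/kerF_exact; exists (u' - v'); rewrite mulmxBl.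
have k0 : @kerF i 0 by apply/kerF_exact; exists 0; rewrite mul0mx.
have kZ r u : @kerF i u -> kerF (r *: u).
  by move=> /kerF_exact [u' ->]; apply/kerF_exact; exists (r *: u'); rewrite -scalemxAl.
by split=> [d|d u v [? ?] [? ?]|d x u [? ?]]; split; auto.
Qed.

Lemma diff_hrow i d u : hrow (@res_shift _ _ _ F i.+1) d u -> cycF d (u *m res_diff F i).
Proof.
move=> hu; split; first exact: (hrow_mulmx (homog_res_diff (i := i)) hu).
by apply/kerF_exact; exists u.
Qed.

Lemma diff_surj i d w : @cycF i d w ->
  exists2 u, hrow (@res_shift _ _ _ F i.+1) d u & u *m res_diff F i = w.
Proof.
move=> [hw /kerF_exact [v E]]; exists (hcomp (@res_shift _ _ _ F i.+1) d v).
  exact: hrow_hcomp.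
by rewrite -(hcomp_mulmx _ _ (homog_res_diff (i := i))) -E hcomp_id.
Qed.

Lemma ker_minimal i u : @kerF i u -> forall k, (u 0 k)@_0%MM = 0.
Proof.
move=> /kerF_exact [v ->] k; rewrite mxE raddf_sum big1 // => j _ /=.
by rewrite mcoeff0M res_minimal mulr0.
Qed.

Lemma cycF0_kerd d u : @cycF 0 d u <-> kerd (@res_shift _ _ _ F 0) augF d u.
Proof. by split=> -[hu Hu]; split=> //; apply/kerF0E. Qed.

(** Two bounds are carried together: the regularity of the syzygies at one place bounds the shifts
    at the next, by minimality, and these shifts in turn bound the regularity of the next syzygies,
    at the cost of one. *)
Theorem kreg_res_shift r : kreg a l (hpart J) (fun _ w => w = 0) r ->
  forall i k, (@res_shift _ _ _ F i k <= r + i)%N.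
Proof.
move=> H; have gJ := gsub_hpart a_var iJ.
suff main i : (forall k, (@res_shift _ _ _ F i k <= r + i)%N) /\
    kreg a l (cycF (i := i)) (fun _ w => w = 0) (r + i).+1.
  by move=> i; have [] := main i.
elim: i => [|i [IH1 IH2]].
  have sr : forall k, (@res_shift _ _ _ F 0 k <= r)%N.
    apply: (shift_le_kreg gJ augFB augFZ augF_hrow augF_surj) H.
    by move=> u /kerF0E /ker_minimal.
  rewrite addn0; split=> //.
  apply: kreg_ext (kreg_step augFB augFZ augF_hrow augF_surj sr H) => // d u.
  exact: iff_sym (cycF0_kerd d u).
pose f (u : 'rV[S]_(res_rank F i.+1)) := u *m res_diff F i.
have fB : {morph f : u v / u - v}.
  by move=> u v; exact: mulmxBl.
have fZ c u : f (c *: u) = c *: f u.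
  exact: esym (scalemxAl _ _ _).
have gZ := gsub_cycF i.
have sr : forall k, (@res_shift _ _ _ F i.+1 k <= r + i.+1)%N.
  rewrite addnS => k; apply: (shift_le_kreg (f := f) gZ fB fZ (@diff_hrow i) (@diff_surj i) _ IH2).
  by move=> u; apply: (@ker_minimal i.+1).
split=> //; rewrite -addnS in IH2.
exact: (kreg_step (f := f) fB fZ (@diff_hrow i) (@diff_surj i) sr IH2).
Qed.

Theorem res_shift_kreg r : (forall i k, (@res_shift _ _ _ F i k <= r + i)%N) ->
  kreg a l (hpart J) (fun _ w => w = 0) r.
Proof.
move=> sr; have gJ := gsub_hpart a_var iJ.
have g0 (W : lmodType S) := gsub0 W a.
(* The induction is on the exterior degree: a cycle over the syzygies at place [i] moves to place
   [i.+1] with [d] raised and [p] lowered by one, which preserves [r + i < d] and ends at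
   [p = 0]. *)
have main p i d : (r + i < d)%N -> kex a p l (cycF (i := i)) (fun _ w => w = 0) d.
  elim: p i d => [|p IH] i d rd; first exact: kex0 (gsub_cycF i) (g0 _).
  apply: (kex_step (f := fun u => u *m res_diff F i) (gsub_cycF i) _ _
    (@diff_hrow i) (@diff_surj i)).
  - by move=> u v; exact: mulmxBl.
  - by move=> c u; rewrite -scalemxAl.
  - by move=> k; apply: leq_trans (sr _ _) _; rewrite addnS.
  - by apply: IH; rewrite addnS ltnS.
apply: kreg_kex => -[|p] d rd; first exact: kex0.
apply: (kex_step gJ augFB augFZ augF_hrow augF_surj).
  by move=> k; apply: leq_trans (sr _ _) _; rewrite addn0.
move=> c fc Mc Nc.
have Mc' : kall (cycF (i := 0) d.+2) c by apply: kall_imp Mc => w /cycF0_kerd.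
have rd' : (r + 0 < d.+1)%N by rewrite addn0 ltnS.
have [b [Mb Nb]] := main p 0%N d.+1 rd' c fc Mc' Nc.
by exists b; split=> //; apply: kall_imp Mb => w /cycF0_kerd.
Qed.
End Koszul_vs_resolution.
End Resolution.

(** * Existence of minimal resolutions *)
Section Dickson.
Variable n : nat.

(** Induction on the number of compared coordinates. The list [s] for [j] coordinates settles every
    [mu] whose coordinate [k0] reaches the maximum [B] of that coordinate over [s]; below [B]
    finitely many values remain, and the induction hypothesis applies to each slice. *)
Lemma dickson_prefix j (P : 'X_{1..n} -> Prop) : exists s : seq 'X_{1..n},
  (forall nu, nu \in s -> P nu) /\
  forall mu, P mu -> exists2 nu, nu \in s & forall i : 'I_n, (i < j)%N -> (nu i <= mu i)%N.
Proof.
elim: j P => [|j IH] P.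
  have [[mu Pmu]|no] := pselect (exists mu, P mu); last first.
    by exists [::]; split=> // mu Pmu; case: no; exists mu.
  exists [:: mu]; split=> [nu|nu _]; first by rewrite inE => /eqP ->.
  by exists mu; rewrite ?inE.
have [jn|nj] := ltnP j n; last first.
  have [s [sP Ps]] := IH P; exists s; split=> // mu /Ps [nu ns H].
  by exists nu => // i _; apply: H; apply: leq_trans (ltn_ord i) nj.
pose k0 := Ordinal jn.
have [s [sP Ps]] := IH P; pose B := (\max_(nu <- s) nu k0)%N.
have [s' [sP' Ps']] : exists s' : seq 'X_{1..n}, (forall nu, nu \in s' -> P nu) /\
    forall mu, P mu -> (mu k0 < B)%N ->
      exists2 nu, nu \in s' & forall i : 'I_n, (i < j.+1)%N -> (nu i <= mu i)%N.
  elim: B => [|B [s1 [sP1 Ps1]]]; first by exists [::].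
  have [s2 [sP2 Ps2]] := IH (fun mu => P mu /\ mu k0 = B).
  exists (s1 ++ s2); split=> [nu|mu Pmu].
    by rewrite mem_cat => /orP [/sP1|/sP2 []].
  rewrite ltnS leq_eqVlt => /orP [/eqP E|/(Ps1 _ Pmu) [nu ns H]]; last first.
    by exists nu; rewrite ?mem_cat ?ns.
  have [nu ns H] := Ps2 mu (conj Pmu E); exists nu; first by rewrite mem_cat ns orbT.
  move=> i; rewrite ltnS leq_eqVlt => /orP [/eqP ij|]; last exact: H.
  by have -> : i = k0 by [apply: val_inj]; rewrite E; have [_ ->] := sP2 nu ns.
exists (s ++ s'); split=> [nu|mu Pmu]; first by rewrite mem_cat => /orP [/sP|/sP'].
have [/(Ps' _ Pmu) [nu ns H]|Bmu] := ltnP (mu k0) B.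
  by exists nu; rewrite ?mem_cat ?ns ?orbT.
have [nu ns H] := Ps mu Pmu; exists nu; first by rewrite mem_cat ns.
move=> i; rewrite ltnS leq_eqVlt => /orP [/eqP ij|]; last exact: H.
have -> : i = k0 by apply: val_inj.
apply: leq_trans Bmu; exact: (@leq_bigmax_seq _ s xpredT (fun nu : 'X_{1..n} => nu k0) nu ns isT).
Qed.

Lemma dickson (P : 'X_{1..n} -> Prop) : exists s : seq 'X_{1..n},
  (forall nu, nu \in s -> P nu) /\
  forall mu, P mu -> exists2 nu, nu \in s & (nu <= mu)%MM.
Proof.
have [s [sP Ps]] := dickson_prefix n P; exists s; split=> // mu /Ps [nu ns H].
by exists nu => //; apply/mnm_lepP => i; apply: H.
Qed.
End Dickson.

(** * Finite generation, minimal covers and their iteration *)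

Section Generators.
Local Open Scope ring_scope.
Variables (K : fieldType) (n : nat).
Local Notation S := {mpoly K[n]}.

Section FinitelyGenerated.
Variables (m : nat) (s : 'I_m -> nat).
Implicit Types (Z : 'rV[S]_m -> Prop) (G : seq 'rV[S]_m).

Definition submod Z := [/\ Z 0, forall u v, Z u -> Z v -> Z (u - v) &
  forall r u, Z u -> Z (r *: u)].

Definition gsubmod Z := submod Z /\ forall d u, Z u -> Z (hcomp s d u).

Definition rspan G u := forall Z, submod Z -> (forall g, g \in G -> Z g) -> Z u.

Lemma submod_rspan G : submod (rspan G).
Proof.
split=> [Z [] //|u v Hu Hv Z sZ GZ|r u Hu Z sZ GZ]; case: (sZ) => _ ZB ZZ; [apply: ZB|apply: ZZ];
  by [apply: Hu|apply: Hv].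
Qed.

Lemma rspan_sub G G' u : {subset G <= G'} -> rspan G u -> rspan G' u.
Proof. by move=> GG Hu Z sZ GZ; apply: Hu => // g /GG /GZ. Qed.

Lemma hcomp_sum (u : 'rV[S]_m) : exists B, u = \sum_(d < B) hcomp s d u.
Proof.
pose B := (\max_k (msize (u 0%R k) + s k))%N; exists B; apply/rowP => k.
rewrite summxE; apply/mpolyP => mu; rewrite raddf_sum /=.
under eq_bigr do rewrite mxE mcoeff_mfilter.
case: (eqVneq (u 0 k)@_mu 0) => [->|umu].
  by rewrite big1 // => i _; rewrite if_same.
have lt : (mdeg mu + s k < B)%N.
  apply: (@leq_trans (msize (u 0%R k) + s k)); last exact: (@leq_bigmax _ (fun k => msize (u 0%R k) + s k)%N k).
  by rewrite ltn_add2r; apply: msize_mdeg_lt; rewrite mcoeff_msupp.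
rewrite (bigD1 (Ordinal lt)) //= eqxx big1 ?addr0 // => i.
by rewrite -val_eqE /= eq_sym => /negbTE ->.
Qed.

Lemma rspan_homog G Z : gsubmod Z ->
  (forall d u, Z u -> hrow s d u -> rspan G u) -> forall u, Z u -> rspan G u.
Proof.
move=> [sZ hZ] H u Zu; have [B ->] := hcomp_sum u; have [G0 GB GZ] := submod_rspan G.
elim/big_ind: _ => [//|v w Gv Gw|d _].
  by rewrite -[w]opprK; apply: (GB) => //; rewrite -sub0r; apply: (GB).
by apply: (H d); [apply: hZ|apply: hrow_hcomp].
Qed.

(* Division with respect to the position-over-term order: an element whose
   entries of index < j vanish is reduced by its entry of index j. *)
Lemma finite_generation_from Z j : gsubmod Z -> exists G : seq 'rV[S]_m,
  (forall g, g \in G -> Z g /\ exists d, hrow s d g) /\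
  forall d u, Z u -> hrow s d u -> (forall k : 'I_m, (k < m - j)%N -> u 0 k = 0) -> rspan G u.
Proof.
move=> gZ; have [[Z0 ZB ZZ] _] := gZ; elim: j => [|j [G [GZ Gspan]]].
  exists [::]; split=> // d u _ _; rewrite subn0 => u0.
  have -> : u = 0 by apply/rowP => k; rewrite mxE u0.
  by case: (submod_rspan [::]).
have [jm|mj] := ltnP j m; last first.
  by exists G; split=> // d u Zu hu u0; apply: Gspan Zu hu _ => k kj; apply: u0; lia.
have kj : (m - j.+1 < m)%N by lia.
pose k0 := Ordinal kj.
pose lead mu u := [/\ Z u, exists d, hrow s d u, forall k : 'I_m, (k < m - j.+1)%N -> u 0 k = 0,
  u 0 k0 != 0 & mlead (u 0 k0) = mu].
(* Finitely many leading monomials at the entry [k0] divide all the others. *)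
have [T [TP PT]] := dickson (fun mu => exists u, lead mu u).
have [U HU] : exists U : 'X_{1..n} -> 'rV[S]_m, forall mu, mu \in T -> lead mu (U mu).
  have : forall mu, exists u, mu \in T -> lead mu u.
    move=> mu; case: (boolP (mu \in T)) => [/TP [u]|_]; last by exists 0.
    by exists u.
  by move=> /choice [U HU]; exists U.
pose G' := map U T ++ G; exists G'; split.
  move=> g; rewrite mem_cat => /orP [/mapP [mu muT ->]|/GZ //].
  by have [? ?] := HU mu muT.
have Gspan' d u : Z u -> hrow s d u -> (forall k : 'I_m, (k < m - j.+1)%N -> u 0 k = 0) ->
    u 0 k0 = 0 -> rspan G' u.
  move=> Zu hu u0 uk; apply: (@rspan_sub G); first by move=> g; rewrite mem_cat orbC => ->.
  apply: Gspan Zu hu _ => k kk; have [/u0 //|kk'] := ltnP k (m - j.+1).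
  by have -> : k = k0 by apply: val_inj => /=; lia.
have [S0 SB SZ] := submod_rspan G'.
suff main mu : forall d u, Z u -> hrow s d u -> (forall k : 'I_m, (k < m - j.+1)%N -> u 0 k = 0) ->
    u 0 k0 != 0 -> mlead (u 0 k0) = mu -> rspan G' u.
  move=> d u Zu hu u0; case: (eqVneq (u 0 k0) 0) => [|uk]; first exact: Gspan' hu u0.
  exact: main hu u0 uk erefl.
elim/(well_founded_ind (@ltom_wf n)): mu => mu IH d u Zu hu u0 uk mu_u.
have [nu nuT nu_mu] : exists2 nu, nu \in T & (nu <= mu)%MM.
  by apply: PT; exists u; split=> //; exists d.
have [Zg [e hg] g0 gk nu_g] := HU nu nuT; set g := U nu in Zg hg g0 gk nu_g.
(* The ratio of leading coefficients, so that [mu] cancels in the entry [k0] of [v]. *)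
pose c := (u 0 k0)@_mu / (g 0 k0)@_nu.
have c0 : c != 0.
  by rewrite mulf_neq0 ?invr_eq0 -?mu_u -?nu_g ?mleadc_eq0.
pose q : S := c *: 'X_[mu - nu]; pose v := u - q *: g.
have rg : rspan G' g by move=> Y sY; apply; rewrite mem_cat map_f.
have -> : u = v - (- q *: g) by rewrite scaleNr opprK subrK.
apply: (SB); last exact: SZ.
have de : (e + mdeg (mu - nu)%MM)%N = d.
  have := hg k0 nu; rewrite -{1}nu_g mleadc_eq0 => /(_ gk) /eqP <-.
  have := hu k0 mu; rewrite -{1}mu_u mleadc_eq0 => /(_ uk) /eqP <-.
  by rewrite addnAC -mdegD addmC submK.
have Zv : Z v by apply: ZB => //; apply: ZZ.
have hv : hrow s d v.
  move=> k; rewrite !mxE; apply: msupB (hu k) _; rewrite mulrC -de.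
  by apply: hshiftM (hg k) _; apply: msupZ; apply: hshiftX.
have v0 (k : 'I_m) : (k < m - j.+1)%N -> v 0 k = 0.
  by move=> kk; rewrite !mxE u0 // g0 // mulr0 subrr.
case: (eqVneq (v 0 k0) 0) => [|vk]; first exact: Gspan' hv v0.
apply: (IH (mlead (v 0 k0)) _ d) => //.
have lq : mlead (q * g 0 k0) = mu.
  have X0 : 'X_[mu - nu] != 0 :> S by rewrite -msize_poly_eq0 msizeX.
  by rewrite /q -scalerAl mleadZ // mleadM // mleadXm nu_g submK.
have Ev : v 0 k0 = u 0 k0 - q * g 0 k0 by rewrite !mxE.
have le : (mlead (v 0 k0) <= mu)%O.
  rewrite Ev; apply: le_trans (mleadB_le _ _) _.
  by rewrite lq mu_u joinxx.
rewrite lt_neqAle le andbT; apply/eqP => E.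
have := vk; rewrite -mleadc_eq0 E Ev mcoeffB.
have -> : (q * g 0 k0)@_mu = (u 0 k0)@_mu.
  have := mcoeffMX (g 0 k0) (mu - nu) nu; rewrite submK // => E2.
  rewrite /q -scalerAl mcoeffZ [_ * g 0 k0]mulrC E2 /c divfK //.
  by rewrite -nu_g mleadc_eq0.
by rewrite subrr eqxx.
Qed.

Lemma finite_generation Z : gsubmod Z -> exists m' (s' : 'I_m' -> nat) (D : 'M[S]_(m', m)),
  homog_mx s' s D /\ forall u, Z u <-> exists v, u = v *m D.
Proof.
move=> gZ; have [[Z0 ZB ZZ] hZ] := gZ; have [G [GZ Gspan]] := finite_generation_from m gZ.
have {}Gspan u : Z u -> rspan G u.
  by move: u; apply: rspan_homog => // d u Zu hu; apply: Gspan Zu hu _ => k; rewrite subnn.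
pose D := \matrix_(i < size G) nth 0 G i.
have rD i : row i D = nth 0 G i by rewrite rowK.
have /choice [s' Hs'] : forall i : 'I_(size G), exists d, hrow s d (nth 0 G i).
  by move=> i; have [_ []] := GZ _ (mem_nth 0 (ltn_ord i)) => d; exists d.
exists (size G), s', D; split; first by move=> k j; rewrite mxE; apply: Hs'.
move=> u; split=> [/Gspan H|[v ->]].
  apply: (H (fun u => exists v, u = v *m D)) => [|g /(nthP 0) [i iG <-]]; last first.
    exists (delta_mx 0 (Ordinal iG)); by rewrite -rowE rD.
  split=> [|_ _ [u1 ->] [u2 ->]|r _ [u1 ->]].
  - by exists 0; rewrite mul0mx.
  - by exists (u1 - u2); rewrite mulmxBl.
  - by exists (r *: u1); rewrite -scalemxAl.
rewrite mulmx_sum_row; elim/big_ind: _ => [//|v1 v2 Z1 Z2|i _].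
  by rewrite -[v2]opprK; apply: (ZB) => //; rewrite -sub0r; apply: (ZB).
by apply: (ZZ); rewrite rD; case: (GZ _ (mem_nth 0 (ltn_ord i))).
Qed.

(* A relation with a unit coefficient makes one generator redundant. *)
Lemma minimal_generation Z : gsubmod Z -> exists m' (s' : 'I_m' -> nat) (D : 'M[S]_(m', m)),
  [/\ homog_mx s' s D, forall u, Z u <-> exists v, u = v *m D &
      forall v : 'rV_m', v *m D = 0 -> forall k, (v 0 k)@_0%MM = 0].
Proof.
move=> /finite_generation [m' [s' [D [hD ZD]]]].
elim: m' => [|m' IH] in s' D hD ZD *.
  by exists 0%N, s', D; split=> // v _ [].
have [[v [k [vD vk]]]|no] := pselect (exists (v : 'rV_m'.+1) k, v *m D = 0 /\ (v 0 k)@_0%MM != 0); last first.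
  exists m'.+1, s', D; split=> // v vD k; apply: contrapT => /eqP vk.
  by case: no; exists v, k.
(* In the degree of the [k]-th generator, the [k]-th entry of the relation reduces to its constant
   term, which is a unit; that generator can then be eliminated. *)
pose w := hcomp s' (s' k) v.
have wD : w *m D = 0.
  rewrite /w -(hcomp_mulmx _ _ hD) vD; apply/rowP => j.
  by rewrite !mxE mfilter0.
have wk : w 0 k = ((v 0 k)@_0%MM)%:MP.
  rewrite mxE; apply/mpolyP => mu; rewrite mcoeff_mfilter mcoeffC.
  rewrite -{2}[s' k]add0n eqn_add2r mdeg_eq0.
  by case: eqP => [->|_]; rewrite ?mulr1 ?mulr0.
apply: (IH (s' \o lift k) (row' k D)) => [i j|u]; first by rewrite mxE; apply: hD.
rewrite ZD; split=> -[x ->]; last first.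
  exists (\row_i if unlift k i is Some i' then x 0 i' else 0).
  apply/rowP => j; rewrite !mxE (bigD1_ord k) //= mxE unlift_none mul0r add0r.
  by apply: eq_bigr => i _; rewrite !mxE liftK.
pose y := x - (x 0 k * ((v 0 k)@_0%MM)^-1%:MP) *: w.
have yk : y 0 k = 0.
  have subE (x1 x2 : 'rV[S]_m'.+1) r : (x1 - r *: x2) 0 k = x1 0 k - r * x2 0 k by rewrite !mxE.
  by rewrite subE wk -mulrA -mpolyCM mulVf // mpolyC1 mulr1 subrr.
have -> : x *m D = y *m D by rewrite mulmxBl -scalemxAl wD scaler0 subr0.
exists (col' k y); apply/rowP => j; rewrite !mxE (bigD1_ord k) //= yk mul0r add0r.
by apply: eq_bigr => i _; rewrite !mxE.
Qed.

End FinitelyGenerated.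

(** Ranks vary along a resolution, so each syzygy module is packed with its ambient free module; the
    resolution then arises from a plain [iter]. *)
Record stage := Stage {
  st_rank : nat;
  st_shift : 'I_st_rank -> nat;
  st_sub : 'rV[S]_st_rank -> Prop;
  st_graded : gsubmod st_shift st_sub }.

Record cover (st : stage) := Cover {
  cv_rank : nat;
  cv_shift : 'I_cv_rank -> nat;
  cv_mx : 'M[S]_(cv_rank, st_rank st);
  cv_homog : homog_mx cv_shift (@st_shift st) cv_mx;
  cv_im : forall u, st_sub u <-> exists v, u = v *m cv_mx;
  cv_min : forall v : 'rV_cv_rank, v *m cv_mx = 0 -> forall k, (v 0 k)@_0%MM = 0 }.

Lemma cover_ex st : exists c : cover st, True.
Proof.
have [m' [s' [D [hD ZD min]]]] := minimal_generation (st_graded st).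
by exists (Cover hD ZD min).
Qed.

Definition cover_of st : cover st := projT1 (cid (cover_ex st)).

Lemma syzygy_graded st (c : cover st) :
  gsubmod (@cv_shift _ c) (fun v : 'rV_(cv_rank c) => v *m cv_mx c = 0).
Proof.
split; first split.
- by rewrite mul0mx.
- by move=> u v u0 v0; rewrite mulmxBl u0 v0 subrr.
- by move=> r u u0; rewrite -scalemxAl u0 scaler0.
- move=> d u u0; rewrite -(hcomp_mulmx _ _ (@cv_homog _ c)) u0.
  by apply/rowP => j; rewrite !mxE mfilter0.
Qed.

Definition syzygy st : stage := Stage (syzygy_graded (cover_of st)).

Theorem min_graded_free_res_ex (J : set S) : ideal J ->
  (forall d p, J p -> J (mfilter (fun m => mdeg m == d) p)) ->
  exists F : min_graded_free_res J, True.
Proof.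
move=> [J0 JB JM] hJ.
have g0 : gsubmod (fun _ : 'I_1 => 0%N) (fun u : 'rV[S]_1 => J (u 0 0)).
  split; first split.
  - by rewrite mxE.
  - by move=> u v Ju Jv; rewrite !mxE; apply: JB.
  - by move=> r u Ju; rewrite mxE; apply: JM.
  - move=> d u Ju; rewrite mxE; under [X in mfilter X]eq_fun do rewrite addn0.
    exact: hJ.
pose st i := iter i syzygy (Stage g0).
pose c i := cover_of (st i).
unshelve refine (ex_intro _ (@MinGradedFreeRes K n J (fun i => cv_rank (c i))
  (fun i => @cv_shift _ (c i)) (cv_mx (c 0%N)) (fun i => cv_mx (c i.+1)) _ _ _ _ _ _) I).
- move=> k; apply/msup_homog; have := @cv_homog _ (c 0%N) k 0.
  by apply: msup_imp => m; rewrite addn0.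
- move=> i k j m; rewrite mcoeff_msupp => H.
  by apply/eqP; apply: (@cv_homog _ (c i.+1) k j m H).
- move=> p; have E := cv_im (c 0%N) (const_mx p); split=> [Jp|[u <-]].
    have [|v Ev] := E.1; first by rewrite /= mxE.
    by exists v; rewrite -Ev mxE.
  by apply: (cv_im (c 0%N) (u *m cv_mx (c 0%N))).2; exists u.
- by move=> u; apply: (cv_im (c 1%N) u).
- by move=> i u; apply: (cv_im (c i.+2) u).
(* The rows of each differential are relations of the previous cover, and these have no constant
   terms. *)
- move=> i k j; have := @cv_min _ (c i) (row k (cv_mx (c i.+1))) _ j.
  rewrite mxE; apply; apply: (cv_im (c i.+1) _).2.
  by exists (delta_mx 0 k); rewrite rowE.
Qed.

End Generators.

(** * Regularity *)
Section Reg.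
Local Open Scope ring_scope.

(** Without an existing least upper bound [supremum] would return its default value. If [A] is
    bounded by an integer [B], minimizing the distance to [B] yields a maximum; otherwise the
    supremum is infinite. *)
Lemma fin_supremums (A : set (\bar int)) : (A !=set0)%classic ->
  (forall x, A x -> exists z, x = z%:E) -> (supremums A !=set0)%classic.
Proof.
move=> [x0 Ax0] Afin; have [z0 E0] := Afin _ Ax0; rewrite {}E0 in Ax0.
have [[B HB]|noB] := pselect (exists B : int, forall z, A z%:E -> (z <= B)%R).
  pose Q k := `[< A (B - k%:Z)%:E >].
  have exQ : exists k, Q k.
    exists `|B - z0|%N; apply/asboolP; rewrite gez0_abs ?subr_ge0 ?HB //.
    by rewrite subKr.
  case: (ex_minnP exQ) => k /asboolP Ak kmin; exists (B - k%:Z)%:E; split; last first.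
    by move=> u; apply.
  move=> x Ax; have [z E] := Afin _ Ax; rewrite {}E in Ax *.
  have zB := HB _ Ax; have := kmin `|B - z|%N.
  rewrite /Q gez0_abs ?subr_ge0 // subKr => /(_ (asboolT Ax)).
  by rewrite lee_fin; lia.
exists +oo%E; split=> [x _|u Hu]; first exact: leey.
case: u Hu => [u||] Hu //; last by have := Hu _ Ax0.
by case: noB; exists u => z Az; have := Hu _ Az; rewrite lee_fin.
Qed.

Variables (K : fieldType) (n : nat) (J : set {mpoly K[n]}).

Lemma reg_le r : (forall (F : min_graded_free_res J) i k, (@res_shift _ _ _ F i k <= r + i)%N) ->
  (reg J <= r%:Z%:E)%E.
Proof.
move=> H; have ub : ubound [set x | exists i j (F : min_graded_free_res J),
    betti F i j != 0%N /\ x = (j%:Z - i%:Z)%:E]%classic r%:Z%:E.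
  move=> x [i [j [F [+ ->]]]]; rewrite /betti -lt0n => /card_gt0P [k].
  by rewrite inE => /eqP <-; have := H F i k; rewrite lee_fin; lia.
rewrite /reg /supremum; case: ifP => _; first exact: leNye.
by case: xgetP => [y _ [_ ]|_]; [apply|exact: leNye].
Qed.

Lemma reg_le_shift r : (reg J <= r%:Z%:E)%E ->
  forall (F : min_graded_free_res J) i k, (@res_shift _ _ _ F i k <= r + i)%N.
Proof.
move=> H F i k; rewrite /reg in H; set A := (X in supremum _ X) in H.
have Ax : A (((@res_shift _ _ _ F i k)%:Z - i%:Z)%:E).
  exists i, (@res_shift _ _ _ F i k), F; split=> //.
  by rewrite -lt0n; apply/card_gt0P; exists k; rewrite inE.
have sA : (supremums A !=set0)%classic.
  apply: fin_supremums; first by exists (((@res_shift _ _ _ F i k)%:Z - i%:Z)%:E).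
  by move=> x [i' [j [F' [_ ->]]]]; exists (j%:Z - i'%:Z).
have := le_trans (ge_supremum_Nmem -oo%E sA Ax) H.
by rewrite lee_fin; lia.
Qed.

Hypothesis iJ : ideal J.

Lemma reg_le_kreg (I : eqType) (a : I -> {mpoly K[n]}) (l : seq I) r :
  (forall x, a x = 0 \/ exists i, a x = 'X_i) ->
  (forall i, exists2 x, x \in l & a x = 'X_i) ->
  kreg a l (hpart J) (fun _ w => w = 0) r -> (reg J <= r%:Z%:E)%E.
Proof. by move=> va cov H; apply: reg_le => F; apply: (kreg_res_shift va cov iJ H). Qed.

Hypothesis hJ : forall d p, J p -> J (mfilter (fun m => mdeg m == d) p).

(** The existence of a resolution enters here: otherwise the set defining [reg] could be empty and
    the hypothesis on it void. *)
Lemma kreg_reg_le (I : eqType) (a : I -> {mpoly K[n]}) (l : seq I) r :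
  (forall x, a x = 0 \/ exists i, a x = 'X_i) ->
  (forall i, exists2 x, x \in l & a x = 'X_i) ->
  (reg J <= r%:Z%:E)%E -> kreg a l (hpart J) (fun _ w => w = 0) r.
Proof.
move=> va cov H; have [F _] := min_graded_free_res_ex iJ hJ.
by apply: (res_shift_kreg va cov iJ (F := F)) => i k; apply: reg_le_shift.
Qed.
End Reg.

(** * Maximal cliques of a graph and of a join *)

Section Cliques.
Variables (V : finType) (G : sgraph V).

Lemma cliqueP (A : {set V}) :
  reflect (forall v w, v \in A -> w \in A -> v != w -> adj G v w) (clique G A).
Proof.
apply: (iffP forallP) => [H v w vA wA vw|H v].
  by have /implyP /(_ vA) /forallP /(_ w) /implyP /(_ wA) /implyP := H v; apply.
by apply/implyP => vA; apply/forallP => w; apply/implyP => wA; apply/implyP; apply: H.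
Qed.

Lemma max_clique_ex (A : {set V}) : clique G A ->
  exists2 B, maxset (clique G) B & A \subset B.
Proof. by move=> /maxset_exists [B mB AB]; exists B. Qed.

Lemma num_max_cliques_gt0 : (0 < num_max_cliques G)%N.
Proof.
have [|B mB _] := @max_clique_ex (@finset.set0 V); first by apply/cliqueP => v w; rewrite inE.
by apply/card_gt0P; exists B; rewrite inE.
Qed.

Lemma one_max_clique : (num_max_cliques G <= 1)%N -> forall v w, v != w -> adj G v w.
Proof.
move=> /card_le1_eqP H v w vw.
have c1 x : clique G [set x].
  by apply/cliqueP => y z; rewrite !inE => /eqP -> /eqP ->; rewrite eqxx.
have [A mA vA] := max_clique_ex (c1 v); have [B mB wB] := max_clique_ex (c1 w).
have AB : A = B by apply: H; rewrite inE.
have /maxsetp /cliqueP := mA; apply=> //; first by rewrite -finset.sub1set.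
by rewrite AB -finset.sub1set.
Qed.
End Cliques.

Section JoinCliques.
Variables (V1 V2 : finType) (G1 : sgraph V1) (G2 : sgraph V2).

Definition join_set (A : {set V1}) (B : {set V2}) : {set V1 + V2} :=
  [set v | match v with inl x => x \in A | inr y => y \in B end].

Lemma join_max_clique A B : maxset (clique G1) A -> maxset (clique G2) B ->
  maxset (clique (graph_join G1 G2)) (join_set A B).
Proof.
move=> /maxsetP [cA mA] /maxsetP [cB mB]; apply/maxsetP; split.
  apply/cliqueP => -[x|x] [y|y]; rewrite !inE //= => xA yA xy.
    by apply: (cliqueP _ _ cA).
  by apply: (cliqueP _ _ cB).
move=> C /cliqueP cC /fintype.subsetP ABC; apply/finset.setP => -[x|x]; rewrite inE.
  rewrite -(mA [set x | inl x \in C]) ?inE //.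
    by apply/cliqueP => v w; rewrite !inE => vC wC vw; apply: (cC (inl v) (inl w)).
  by apply/fintype.subsetP => v vA; rewrite inE; apply: ABC; rewrite inE.
rewrite -(mB [set x | inr x \in C]) ?inE //.
  by apply/cliqueP => v w; rewrite !inE => vC wC vw; apply: (cC (inr v) (inr w)).
by apply/fintype.subsetP => v vA; rewrite inE; apply: ABC; rewrite inE.
Qed.

(** Joining with a fixed maximal clique of the other graph is an injection on maximal cliques. *)
Lemma num_max_cliques_join :
  (num_max_cliques G1 <= num_max_cliques (graph_join G1 G2))%N /\
  (num_max_cliques G2 <= num_max_cliques (graph_join G1 G2))%N.
Proof.
have /card_gt0P [A0] := num_max_cliques_gt0 G1; rewrite inE => mA0.
have /card_gt0P [B0] := num_max_cliques_gt0 G2; rewrite inE => mB0.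
split; rewrite /num_max_cliques.
  rewrite -(card_imset _ (f := fun A => join_set A B0)).
    apply: subset_leq_card; apply/fintype.subsetP => C /imsetP [A]; rewrite !inE => mA ->.
    exact: join_max_clique.
  by move=> A A' /finset.setP E; apply/finset.setP => x; have := E (inl x); rewrite !inE.
rewrite -(card_imset _ (f := fun B => join_set A0 B)).
  apply: subset_leq_card; apply/fintype.subsetP => C /imsetP [B]; rewrite !inE => mB ->.
  exact: join_max_clique.
by move=> B B' /finset.setP E; apply/finset.setP => x; have := E (inr x); rewrite !inE.
Qed.
End JoinCliques.

(** * Binomial edge ideals *)
Section EdgeIdeal.
Local Open Scope ring_scope.
Variables (K : fieldType) (V : finType) (le : rel V) (G : sgraph V).
Hypothesis le_total : total_order le.
Local Notation S := {mpoly K[#|V| + #|V|]}.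
Local Notation J := (binomial_edge_ideal K le G).

Definition edge_binomial (v w : V) : S := xvar K v * yvar K w - xvar K w * yvar K v.

Lemma edge_binomialC v w : edge_binomial w v = - edge_binomial v w.
Proof. by rewrite opprB. Qed.

Lemma edge_ideal_ideal : ideal J.
Proof.
split.
- by exists (fun _ => 0); rewrite big1 // => e _; rewrite mul0r.
- move=> p q [c ->] [c' ->]; exists (fun e => c e - c' e); rewrite -sumrB.
  by apply: eq_bigr => e _; rewrite mulrBl.
- move=> p q [c ->]; exists (fun e => p * c e); rewrite mulr_sumr.
  by apply: eq_bigr => e _; rewrite mulrA.
Qed.

Lemma edge_ideal_graded d p : J p -> J (mfilter (fun m => mdeg m == d) p).
Proof.
(* The generators are quadrics, so the coefficients are cut to degree [d - 2], written without
   truncated subtraction. *)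
move=> [c ->]; exists (fun e => mfilter (fun m => mdeg m + 2 == d)%N (c e)).
rewrite mfilter_sum; apply: eq_bigr => e _.
apply: (mfilterM (T := fun m => mdeg m == 2%N)); last by move=> m m' /eqP <-; rewrite mdegD.
by apply: msupB; rewrite -mpolyXD; apply: msupX; rewrite mdegD !mdeg1.
Qed.

Lemma edge_ideal_adj v w : adj G v w -> J (edge_binomial v w).
Proof.
have main x y : adj G x y -> le x y -> J (edge_binomial x y).
  move=> xy lxy; exists (fun e => (e == (x, y))%:R).
  rewrite (bigD1 (x, y)) /=; last first.
    by rewrite xy lxy !andbT; apply: contraTneq xy => ->; rewrite adj_irr.
  by rewrite eqxx mul1r big1 ?addr0 // => e /andP [_ /negbTE ->]; rewrite mul0r.
case: le_total => _ _ _ tot vw; case/orP: (tot v w) => [|lwv]; first exact: main.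
have [J0 JB _] := edge_ideal_ideal.
rewrite edge_binomialC -sub0r; apply: JB => //; apply: main => //.
by rewrite adj_sym.
Qed.

Lemma edge_ideal_min (Y : S -> Prop) : ideal Y ->
  (forall v w, adj G v w -> Y (edge_binomial v w)) -> forall p, J p -> Y p.
Proof.
move=> iY H p [c ->]; apply: ideal_sum => // e /and3P [_ _ Ge].
by have [_ _ YM] := iY; apply: YM; apply: H.
Qed.

End EdgeIdeal.

(** * The ideal of all 2-minors *)

Section MinorIdeal.
Local Open Scope ring_scope.
Variables (K : fieldType) (V : finType).
Local Notation S := {mpoly K[#|V| + #|V|]}.

(** With all columns listed no [z_i] is killed, so this is the kernel of the map [segre] induces. *)
Definition minor_ideal : S -> Prop := minors (K := K) (enum 'I_#|V|).

Lemma minor_ideal_ideal : ideal minor_ideal.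
Proof. exact: ideal_minors. Qed.

Lemma minor_ideal_edge v w : minor_ideal (edge_binomial K v w).
Proof. exact: minors_minor. Qed.

Lemma minor_ideal_min (Y : S -> Prop) : ideal Y ->
  (forall v w, v != w -> Y (edge_binomial K v w)) -> forall p, minor_ideal p -> Y p.
Proof.
move=> iY H p Pp; apply: (segre_ker iY) => [i j|].
  rewrite -(enum_valK i) -(enum_valK j) -/(edge_binomial K (enum_val i) (enum_val j)).
  case: (eqVneq (enum_val i) (enum_val j)) => [->|]; last exact: H.
  by rewrite /edge_binomial subrr; case: iY.
apply/mpolyP => m; rewrite mcoeff0; apply: contrapT => /eqP /Pp /existsP [j /andP [+ _]].
by rewrite /out; case: splitP => // i _; rewrite mem_enum.
Qed.

(** The Segre map turns the degree into the degree in the [z_i], so it commutes with taking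
    homogeneous components. *)
Lemma minor_ideal_graded d p : minor_ideal p -> minor_ideal (mfilter (fun m => mdeg m == d) p).
Proof.
rewrite /minor_ideal /minors => Pp.
suff -> : monomial_map (K := K) (@segre #|V|) (mfilter (fun m => mdeg m == d) p) =
    mfilter (fun mu => (\sum_i mu (lshift 1 i))%N == d) (monomial_map (@segre #|V|) p).
  exact: msup_mfilterW.
have E c m : monomial_map (@segre #|V|) (c *: 'X_[m]) = c *: 'X_[K, mnm_map (@segre #|V|) m].
  by rewrite -monomial_mapX /monomial_map comp_mpolyZ.
have fE k (Q : pred 'X_{1..k}) c m :
    mfilter Q (c *: 'X_[m]) = if Q m then c *: 'X_[m] else 0 :> {mpoly K[k]}.
  apply/mpolyP => m'; rewrite mcoeff_mfilter; case: (boolP (Q m)) => Qm.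
    case: ifP => // Qm'; rewrite mcoeffZ mcoeffX; case: eqP => [E'|_]; last by rewrite mulr0.
    by rewrite -E' Qm in Qm'.
  rewrite mcoeff0 mcoeffZ mcoeffX; case: ifP => // Qm'.
  by case: eqP => [E'|_]; rewrite ?mulr0 // E' Qm' in Qm *.
rewrite [p]mpolyE mfilter_sum !(raddf_sum (monomial_map _)) mfilter_sum /=.
apply: eq_bigr => m _; rewrite E !fE -mdeg_ka.
by case: ifP => _; rewrite ?E // raddf0.
Qed.

(** Both bounds amount to the same bound on the shifts of one resolution, so repeating variables or
    adding zero operators changes nothing. *)
Lemma kreg_relabel n (Y : {mpoly K[n]} -> Prop) (I I' : eqType) (a : I -> {mpoly K[n]})
    (a' : I' -> {mpoly K[n]}) (l : seq I) (l' : seq I') r : ideal Y ->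
  (forall d p, Y p -> Y (mfilter (fun m => mdeg m == d) p)) ->
  (forall x, a x = 0 \/ exists i, a x = 'X_i) ->
  (forall i, exists2 x, x \in l & a x = 'X_i) ->
  (forall x, a' x = 0 \/ exists i, a' x = 'X_i) ->
  (forall i, exists2 x, x \in l' & a' x = 'X_i) ->
  kreg a l (hpart Y) (fun _ w => w = 0) r -> kreg a' l' (hpart Y) (fun _ w => w = 0) r.
Proof.
move=> iY hY va cov va' cov' H.
have [F _] := min_graded_free_res_ex iY hY.
by apply: (res_shift_kreg va' cov' iY (F := F)); exact: (kreg_res_shift va cov iY H).
Qed.

Lemma kreg_minor_ideal (I : eqType) (a : I -> S) (l : seq I) :
  (forall x, a x = 0 \/ exists i, a x = 'X_i) ->
  (forall i, exists2 x, x \in l & a x = 'X_i) ->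
  kreg a l (hpart minor_ideal) (fun _ w => w = 0) 2.
Proof.
move=> va cov; pose b (i : 'I_(#|V| + #|V|)) : S := 'X_i.
have vb i : b i = 0 \/ exists j, b i = 'X_j by right; exists i.
pose lb := labels (@xi #|V|) (@yi #|V|) (enum 'I_#|V|).
have covb i : exists2 j, j \in lb & b j = 'X_i.
  exists i => //; case: (splitP i) => j ij.
    have -> : i = xi j by apply: val_inj.
    by apply: (mem_labels _ _ _).1; rewrite mem_enum.
  have -> : i = yi j by apply: val_inj.
  by apply: (mem_labels _ _ _).2; rewrite mem_enum.
apply: (kreg_relabel minor_ideal_ideal minor_ideal_graded vb covb va cov).
(* Regularity 1 of the quotient by the minors becomes 2 for the ideal, the ring itself having
   regularity 0. *)
apply: (@kreg_sub _ _ _ _ _ (hshift 0 : nat -> S^o -> Prop)).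
- exact: gsub_hshift.
- exact: gsub_hpart minor_ideal_ideal.
- by move=> d w [].
- by move=> d w ->; case: (gsub_hpart vb minor_ideal_ideal).
- by apply: (kreg_minors vb) => //; apply: enum_uniq.
- exact: kreg_le (kreg_hshift vb covb).
Qed.
End MinorIdeal.

(** * Restricting and extending the set of vertices *)

Section Substitution.
Local Open Scope ring_scope.
Variables (K : fieldType) (n k : nat).

Lemma mpoly_ring_ind (Q : {mpoly K[n]} -> Prop) :
  (forall p q, Q p -> Q q -> Q (p + q)) -> (forall p q, Q p -> Q q -> Q (p * q)) ->
  (forall c, Q c%:MP) -> (forall i, Q 'X_i) -> forall p, Q p.
Proof.
move=> QD QM QC QX p; rewrite [p]mpolyE; elim/big_ind: _ => //.
  by rewrite -mpolyC0.
move=> m _; rewrite -mul_mpolyC; apply: (QM) => //; rewrite mpolyXE_id.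
elim/big_ind: _ => // [|i _]; first by rewrite -mpolyC1.
by elim: (m i) => [|j IH]; rewrite ?expr0 -?mpolyC1 ?exprS //; apply: (QM).
Qed.

Lemma hshift_comp (t : n.-tuple {mpoly K[k]}) d p : (forall i, hshift 0 1 (tnth t i)) ->
  hshift 0 d p -> hshift 0 d (p \mPo t).
Proof.
move=> ht hp; rewrite [p]mpolyE raddf_sum /= big_seq; apply: msup_sum => m.
rewrite mcoeff_msupp => /hp; rewrite addn0 => /eqP <-.
rewrite comp_mpolyZ; apply: msupZ; rewrite comp_mpolyX mdegE.
apply: (big_ind2 (fun p e => hshift 0 e p)) => [|p1 e1 p2 e2 h1 h2|i _].
- by rewrite -mpolyX0; apply: msupX; rewrite mdeg0.
- exact: hshiftM.
- elim: (m i) => [|j IH]; last by rewrite exprS; exact: (hshiftM (ht i) IH).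
  by rewrite expr0 -mpolyX0; apply: msupX; rewrite mdeg0.
Qed.
End Substitution.

Section Restriction.
Local Open Scope ring_scope.
Variables (K : fieldType) (U V : finType) (e : U -> V).
Hypothesis e_inj : injective e.
Local Notation SU := {mpoly K[#|U| + #|U|]}.
Local Notation S := {mpoly K[#|V| + #|V|]}.

Definition restr_var (j : 'I_(#|V| + #|V|)) : SU :=
  match split j with
  | inl i => if [pick u | e u == enum_val i] is Some u then xvar K u else 0
  | inr i => if [pick u | e u == enum_val i] is Some u then yvar K u else 0
  end.
Definition extend_var (j : 'I_(#|U| + #|U|)) : S :=
  match split j with
  | inl i => xvar K (e (enum_val i))
  | inr i => yvar K (e (enum_val i))
  end.

Definition restr : S -> SU := comp_mpoly [tuple restr_var j | j < #|V| + #|V|].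
Definition extend : SU -> S := comp_mpoly [tuple extend_var j | j < #|U| + #|U|].
HB.instance Definition _ := GRing.RMorphism.on restr.
HB.instance Definition _ := GRing.RMorphism.on extend.

Lemma restrX j : restr 'X_j = restr_var j.
Proof. by rewrite /restr comp_mpolyXU -tnth_nth tnth_mktuple. Qed.
Lemma extendX j : extend 'X_j = extend_var j.
Proof. by rewrite /extend comp_mpolyXU -tnth_nth tnth_mktuple. Qed.

Lemma pick_e u : [pick u' | e u' == e u] = Some u.
Proof. by case: pickP => [u' /eqP /e_inj -> //|/(_ u)]; rewrite eqxx. Qed.

Lemma pick_out v : (forall u, e u <> v) -> [pick u' | e u' == v] = None.
Proof. by move=> H; case: pickP => // u /eqP /H. Qed.

Lemma restr_in u : restr (xvar K (e u)) = xvar K u /\ restr (yvar K (e u)) = yvar K u.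
Proof.
split; rewrite restrX /restr_var.
  by have /= -> := unsplitK (inl (enum_rank (e u)) : 'I_#|V| + 'I_#|V|); rewrite enum_rankK pick_e.
by have /= -> := unsplitK (inr (enum_rank (e u)) : 'I_#|V| + 'I_#|V|); rewrite enum_rankK pick_e.
Qed.

Lemma restr_out v : (forall u, e u <> v) -> restr (xvar K v) = 0 /\ restr (yvar K v) = 0.
Proof.
move=> H; split; rewrite restrX /restr_var.
  by have /= -> := unsplitK (inl (enum_rank v) : 'I_#|V| + 'I_#|V|); rewrite enum_rankK pick_out.
by have /= -> := unsplitK (inr (enum_rank v) : 'I_#|V| + 'I_#|V|); rewrite enum_rankK pick_out.
Qed.

Lemma extend_in u : extend (xvar K u) = xvar K (e u) /\ extend (yvar K u) = yvar K (e u).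
Proof.
split; rewrite extendX /extend_var.
  by have /= -> := unsplitK (inl (enum_rank u) : 'I_#|U| + 'I_#|U|); rewrite enum_rankK.
by have /= -> := unsplitK (inr (enum_rank u) : 'I_#|U| + 'I_#|U|); rewrite enum_rankK.
Qed.

Lemma var_cases (W : finType) (j : 'I_(#|W| + #|W|)) :
  exists w, 'X_j = xvar K w \/ 'X_j = yvar K w.
Proof.
case: (splitP j) => i ij; exists (enum_val i); [left|right]; rewrite /xvar /yvar enum_valK;
  by congr 'X_(_); apply: val_inj.
Qed.

Lemma restrK p : restr (extend p) = p.
Proof.
elim/mpoly_ring_ind: p => [p q Ep Eq|p q Ep Eq|c|j].
- by rewrite !rmorphD /= Ep Eq.
- by rewrite !rmorphM /= Ep Eq.
- by rewrite /extend /restr !comp_mpolyC.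
have [u [->|->]] := var_cases j.
  by rewrite (extend_in u).1 (restr_in u).1.
by rewrite (extend_in u).2 (restr_in u).2.
Qed.

(** Makes the restricted variables admissible operators, so the variables of the large ring act on
    modules over the small one. *)
Lemma restr_var_cases j : restr 'X_j = 0 \/ exists i, restr 'X_j = 'X_i.
Proof.
have [v E] := var_cases j; have [[u uv]|no] := pselect (exists u, e u = v).
  right; rewrite -uv in E; case: E => ->; [exists (lshift #|U| (enum_rank u))|exists (rshift #|U| (enum_rank u))].
    exact: (restr_in u).1.
  exact: (restr_in u).2.
have H u : e u <> v by move=> E'; apply: no; exists u.
by left; case: E => ->; case: (restr_out H).
Qed.

Lemma restr_cover i : exists j, restr 'X_j = 'X_i.
Proof.
have [u [->|->]] := var_cases i.
  by exists (lshift #|V| (enum_rank (e u))); apply: (restr_in u).1.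
by exists (rshift #|V| (enum_rank (e u))); apply: (restr_in u).2.
Qed.

Lemma hshift_restr d p : hshift 0 d p -> hshift 0 d (restr p).
Proof.
apply: hshift_comp => j; rewrite tnth_mktuple -restrX.
case: (restr_var_cases j) => [->|[i ->]]; first exact: msup0.
by apply: msupX; rewrite mdeg1.
Qed.

Lemma hshift_extend d p : hshift 0 d p -> hshift 0 d (extend p).
Proof.
apply: hshift_comp => j; rewrite tnth_mktuple -extendX.
have [u [->|->]] := var_cases j.
  by rewrite (extend_in u).1; apply: msupX; rewrite mdeg1.
by rewrite (extend_in u).2; apply: msupX; rewrite mdeg1.
Qed.

Lemma restr_edge u u' : restr (edge_binomial K (e u) (e u')) = edge_binomial K u u'.
Proof.
rewrite /edge_binomial rmorphB !rmorphM /=.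
by rewrite !(restr_in u).1 !(restr_in u').1 !(restr_in u).2 !(restr_in u').2.
Qed.

Lemma extend_edge u u' : extend (edge_binomial K u u') = edge_binomial K (e u) (e u').
Proof.
rewrite /edge_binomial rmorphB !rmorphM /=.
by rewrite !(extend_in u).1 !(extend_in u').1 !(extend_in u).2 !(extend_in u').2.
Qed.

Lemma restr_edge_out v w : (forall u, e u <> v) -> restr (edge_binomial K v w) = 0.
Proof.
move=> H; rewrite /edge_binomial rmorphB !rmorphM /=.
by rewrite (restr_out H).1 (restr_out H).2 mul0r mulr0 subrr.
Qed.

Lemma restr_edge_outr v w : (forall u, e u <> w) -> restr (edge_binomial K v w) = 0.
Proof.
move=> H; rewrite /edge_binomial rmorphB !rmorphM /=.
by rewrite (restr_out H).1 (restr_out H).2 mul0r mulr0 subrr.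
Qed.

(** To be applied with [M] the annihilator of a minor modulo the edge ideal of the join, which
    contains the variables of the other side. *)
Lemma extend_restr_mod (M : S -> Prop) : ideal M ->
  (forall v, (forall u, e u <> v) -> M (xvar K v) /\ M (yvar K v)) ->
  forall p, M (p - extend (restr p)).
Proof.
move=> iM HM; have [M0 MB MM] := iM.
elim/mpoly_ring_ind => [p q Mp Mq|p q Mp Mq|c|j].
- by rewrite !rmorphD /= opprD addrACA; apply: idealD.
- rewrite !rmorphM /=.
  have -> : p * q - extend (restr p) * extend (restr q) =
    p * (q - extend (restr q)) + extend (restr q) * (p - extend (restr p)) by ring.
  by apply: idealD => //; apply: MM.
- by rewrite /extend /restr !comp_mpolyC subrr.
have [v E] := var_cases j; have [[u uv]|no] := pselect (exists u, e u = v).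
  rewrite -uv in E; case: E => ->.
    by rewrite (restr_in u).1 (extend_in u).1 subrr.
  by rewrite (restr_in u).2 (extend_in u).2 subrr.
have H u : e u <> v by move=> E'; apply: no; exists u.
have [Mx My] := HM v H.
case: E => ->; first by rewrite (restr_out H).1 rmorph0 subr0.
by rewrite (restr_out H).2 rmorph0 subr0.
Qed.
End Restriction.

(** * Joins *)
Section Join.
Local Open Scope ring_scope.
Variables (K : fieldType) (V1 V2 : finType) (G1 : sgraph V1) (G2 : sgraph V2).
Variables (le1 : rel V1) (le2 : rel V2) (le12 : rel (V1 + V2)%type).
Hypotheses (ord1 : total_order le1) (ord2 : total_order le2) (ord12 : total_order le12).
Local Notation V := ((V1 + V2)%type : finType).
Local Notation S := {mpoly K[#|V| + #|V|]}.
Local Notation J1 := (binomial_edge_ideal K le1 G1).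
Local Notation J2 := (binomial_edge_ideal K le2 G2).
Local Notation J := (binomial_edge_ideal K le12 (graph_join G1 G2)).
Local Notation in1 := (@inl V1 V2).
Local Notation in2 := (@inr V1 V2).
Local Notation r1 := (@restr K _ _ in1).
Local Notation r2 := (@restr K _ _ in2).
Local Notation x1 := (@extend K _ _ in1).
Local Notation x2 := (@extend K _ _ in2).
Local Notation f v w := (edge_binomial K v w).

Let inj1 : injective in1. Proof. by move=> x y []. Qed.
Let inj2 : injective in2. Proof. by move=> x y []. Qed.
Let out1 (y : V2) (u : V1) : in1 u <> inr y. Proof. by []. Qed.
Let out2 (x : V1) (u : V2) : in2 u <> inl x. Proof. by []. Qed.
Let iJ : ideal J := edge_ideal_ideal K le12 (graph_join G1 G2).

Lemma join_edge v w : adj (graph_join G1 G2) v w -> J (f v w).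
Proof. exact: (edge_ideal_adj K ord12). Qed.

(* A Pluecker relation expresses x_k f_(v,w) and y_k f_(v,w) by f_(k,v), f_(k,w). *)
Lemma plucker (k v w : V) : J (f k v) -> J (f k w) ->
  J (xvar K k * f v w) /\ J (yvar K k * f v w).
Proof.
have [_ JB JM] := iJ; move=> Jv Jw; split.
  have -> : xvar K k * f v w = xvar K v * f k w - xvar K w * f k v.
    by rewrite /edge_binomial; ring.
  by apply: JB; apply: JM.
have -> : yvar K k * f v w = yvar K v * f k w - yvar K w * f k v.
  by rewrite /edge_binomial; ring.
by apply: JB; apply: JM.
Qed.

Lemma annihilator_ideal v w : ideal (fun q => J (q * f v w)).
Proof.
have [J0 JB JM] := iJ; split=> [|p q Hp Hq|p q Hq].
- by rewrite mul0r.
- by rewrite mulrBl; apply: JB.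
- by rewrite -mulrA; apply: JM.
Qed.

Lemma join_decomposition p : @minor_ideal K V p -> J (p - x1 (r1 p) - x2 (r2 p)).
Proof.
have [J0 JB JM] := iJ.
(* The map in the statement is not linear over the ring; quantifying over all multiples [c * q]
   makes [Y] an ideal, so checking the minors suffices. *)
pose Y q := forall c : S, J (c * q - x1 (r1 (c * q)) - x2 (r2 (c * q))).
move=> Pp; suff /(_ 1) : Y p by rewrite mul1r.
move: p Pp; apply: minor_ideal_min.
  split=> [c|p q Hp Hq c|p q Hq c].
  - by rewrite mulr0 !rmorph0 !subr0.
  - rewrite mulrBr !rmorphB /=.
    set A := c * p; set B := c * q.
    have -> : A - B - (x1 (r1 A) - x1 (r1 B)) -
        (x2 (r2 A) - x2 (r2 B)) =
      (A - x1 (r1 A) - x2 (r2 A)) -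
      (B - x1 (r1 B) - x2 (r2 B)) by ring.
    by apply: JB; [apply: Hp|apply: Hq].
  - by rewrite mulrA; apply: Hq.
move=> [x|x] [y|y] _ c; rewrite !rmorphM /=.
(* For a minor on one side, [c] differs from its restriction by terms in variables of the other
   side, which annihilate the minor modulo [J]. A mixed minor belongs to an edge of the join, and
   both restrictions kill it. *)
- rewrite (restr_edge K inj1) extend_edge (restr_edge_out K _ (@out2 x)) rmorph0 mulr0 subr0.
  rewrite -mulrBl; apply: (extend_restr_mod inj1 (annihilator_ideal _ _)) => -[z|z] Hz.
    by case: (Hz z).
  by apply: plucker; apply: join_edge.
- rewrite (restr_edge_out K _ (@out2 x)) (restr_edge_outr K _ (@out1 y)).
  by rewrite !rmorph0 !mulr0 !subr0; apply: JM; apply: join_edge.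
- rewrite (restr_edge_out K _ (@out1 x)) (restr_edge_outr K _ (@out2 y)).
  by rewrite !rmorph0 !mulr0 !subr0; apply: JM; apply: join_edge.
rewrite (restr_edge_out K _ (@out1 x)) (restr_edge K inj2) extend_edge !rmorph0 mulr0 subr0.
rewrite -mulrBl; apply: (extend_restr_mod inj2 (annihilator_ideal _ _)) => -[z|z] Hz.
  by apply: plucker; apply: join_edge.
by case: (Hz z).
Qed.

Lemma preim_ideal n n' (h : {rmorphism {mpoly K[n]} -> {mpoly K[n']}}) Y :
  ideal Y -> ideal (fun p => Y (h p)).
Proof.
move=> [Y0 YB YM]; split=> [|p q Yp Yq|p q Yq].
- by rewrite rmorph0.
- by rewrite rmorphB; apply: YB.
- by rewrite rmorphM; apply: YM.
Qed.

Lemma ideal_and n (Y Z : {mpoly K[n]} -> Prop) :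
  ideal Y -> ideal Z -> ideal (fun p => Y p /\ Z p).
Proof.
move=> [Y0 YB YM] [Z0 ZB ZM]; split=> // [p q [? ?] [? ?]|p q [? ?]]; split; auto.
Qed.

Lemma join_adj1 v w : adj (graph_join G1 G2) v w -> J1 (r1 (f v w)) /\ J2 (r2 (f v w)).
Proof.
have J10 : J1 0 by case: (edge_ideal_ideal K le1 G1).
have J20 : J2 0 by case: (edge_ideal_ideal K le2 G2).
case: v w => x [y|y] /= xy.
- rewrite (restr_edge K inj1) (restr_edge_out K _ (@out2 x)); split=> //.
  exact: edge_ideal_adj.
- by rewrite (restr_edge_out K _ (@out2 x)) (restr_edge_outr K _ (@out1 y)).
- by rewrite (restr_edge_out K _ (@out1 x)) (restr_edge_outr K _ (@out2 y)).
- rewrite (restr_edge K inj2) (restr_edge_out K _ (@out1 x)); split=> //.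
  exact: edge_ideal_adj.
Qed.

Lemma restr_join_ideal p : J p -> J1 (r1 p) /\ J2 (r2 p).
Proof.
move: p; apply: (@edge_ideal_min _ _ _ _ (fun p => J1 (r1 p) /\ J2 (r2 p))); last exact: join_adj1.
by apply: ideal_and; apply: preim_ideal; apply: edge_ideal_ideal.
Qed.

Lemma restr_minor_ideal p : @minor_ideal K V p -> minor_ideal (r1 p) /\ minor_ideal (r2 p).
Proof.
move: p; apply: (@minor_ideal_min _ _ (fun p => minor_ideal (r1 p) /\ minor_ideal (r2 p))).
  by apply: ideal_and; apply: preim_ideal; apply: minor_ideal_ideal.
have P10 : @minor_ideal K V1 0 by case: (minor_ideal_ideal K V1).
have P20 : @minor_ideal K V2 0 by case: (minor_ideal_ideal K V2).
move=> [x|x] [y|y] _.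
- by rewrite (restr_edge K inj1) (restr_edge_out K _ (@out2 x)); split=> //; apply: minor_ideal_edge.
- by rewrite (restr_edge_out K _ (@out2 x)) (restr_edge_outr K _ (@out1 y)).
- by rewrite (restr_edge_out K _ (@out1 x)) (restr_edge_outr K _ (@out2 y)).
- by rewrite (restr_edge K inj2) (restr_edge_out K _ (@out1 x)); split=> //; apply: minor_ideal_edge.
Qed.

Lemma extend_minor_ideal (U : finType) (e : U -> V) p : @minor_ideal K U p ->
  @minor_ideal K V (extend e p).
Proof.
move: p; apply: (@minor_ideal_min _ _ (fun p => minor_ideal (extend e p))).
  by apply: preim_ideal; apply: minor_ideal_ideal.
by move=> v w _; rewrite extend_edge; apply: minor_ideal_edge.
Qed.

(** The composite keeps constant terms, hence the restriction to an ideal without them. *)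
Lemma restr1_extend2 p : @minor_ideal K V2 p -> r1 (x2 p) = 0.
Proof.
move: p; apply: (@minor_ideal_min _ _ (fun p => r1 (x2 p) = 0)) => [|v w _].
  split=> [|p' q Hp Hq|p' q Hq]; first by rewrite !rmorph0.
    by rewrite !rmorphB /= Hp Hq subrr.
  by rewrite !rmorphM /= Hq mulr0.
by rewrite extend_edge (restr_edge_out K _ (@out1 v)).
Qed.

(* The middle term of J <= Q <= P, with P/Q = P1/J1 and Q/J = P2/J2. *)
Definition mid_ideal (p : S) := minor_ideal p /\ J1 (r1 p).

Lemma mid_ideal_ideal : ideal mid_ideal.
Proof.
apply: ideal_and; first exact: minor_ideal_ideal.
by apply: preim_ideal; apply: edge_ideal_ideal.
Qed.

Lemma join_ideal_minor p : J p -> minor_ideal p.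
Proof.
move: p; apply: edge_ideal_min; first exact: minor_ideal_ideal.
by move=> v w _; apply: minor_ideal_edge.
Qed.

Lemma join_ideal_mid p : J p -> mid_ideal p.
Proof. by move=> Jp; split; [apply: join_ideal_minor|case: (restr_join_ideal Jp)]. Qed.

(** Injectivity of the map from P/J to the sum of [P_1/J_1] and [P_2/J_2], by the decomposition
    modulo [J]. *)
Lemma join_ideal_restr p : minor_ideal p -> J1 (r1 p) -> J2 (r2 p) -> J p.
Proof.
move=> Pp J1p J2p; have [J0 JB JM] := iJ.
have ext1 : forall q, J1 q -> J (x1 q).
  apply: (@edge_ideal_min _ _ _ _ (fun q => J (x1 q))); first exact: preim_ideal iJ.
  by move=> v w vw; rewrite extend_edge; apply: join_edge.
have ext2 : forall q, J2 q -> J (x2 q).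
  apply: (@edge_ideal_min _ _ _ _ (fun q => J (x2 q))); first exact: preim_ideal iJ.
  by move=> v w vw; rewrite extend_edge; apply: join_edge.
have -> : p = (p - x1 (r1 p) - x2 (r2 p)) +
    (x1 (r1 p) + x2 (r2 p)) by ring.
apply: (idealD iJ); first exact: join_decomposition.
by apply: (idealD iJ); [apply: ext1|apply: ext2].
Qed.

Local Notation a := (fun j : 'I_(#|V| + #|V|) => 'X_j : S).
Local Notation a1 := (fun j : 'I_(#|V| + #|V|) => r1 'X_j).
Local Notation a2 := (fun j : 'I_(#|V| + #|V|) => r2 'X_j).
Local Notation l := (enum 'I_(#|V| + #|V|)).
Local Notation zero := (fun _ w => w = 0).

Let va j : a j = 0 \/ exists i, a j = 'X_i. Proof. by right; exists j. Qed.
Let va1 j : a1 j = 0 \/ exists i, a1 j = 'X_i. Proof. exact: restr_var_cases. Qed.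
Let va2 j : a2 j = 0 \/ exists i, a2 j = 'X_i. Proof. exact: restr_var_cases. Qed.
Let cov i : exists2 j, j \in l & a j = 'X_i. Proof. by exists i; rewrite ?mem_enum. Qed.
Let cov1 i : exists2 j, j \in l & a1 j = 'X_i.
Proof. by have [j E] := restr_cover K inj1 i; exists j; rewrite ?mem_enum. Qed.
Let cov2 i : exists2 j, j \in l & a2 j = 'X_i.
Proof. by have [j E] := restr_cover K inj2 i; exists j; rewrite ?mem_enum. Qed.

(** The connecting map saves one degree on the edge ideal, while [2 <= r] is imposed by the ideal of
    minors. *)
Lemma kreg_minor_mod_edge (U : finType) (G : sgraph U) (leU : rel U) (I : eqType)
    (b : I -> {mpoly K[#|U| + #|U|]}) (lb : seq I) r :
  (forall x, b x = 0 \/ exists i, b x = 'X_i) ->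
  (forall i, exists2 x, x \in lb & b x = 'X_i) -> (2 <= r)%N ->
  (reg (binomial_edge_ideal K leU G) <= r.+1%:Z%:E)%E ->
  kreg b lb (hpart (@minor_ideal K U)) (hpart (binomial_edge_ideal K leU G)) r.
Proof.
move=> vb covb r2' H.
have iP := minor_ideal_ideal K U; have iE := edge_ideal_ideal K leU G.
apply: (@kreg_quot _ _ _ _ _ _ _ (fun _ w => w = 0)).
- exact: gsub_hpart.
- exact: gsub_hpart.
- exact: gsub0.
- move=> d p [Ep hp]; split=> //.
  by move: p Ep {hp}; apply: edge_ideal_min => // v w _; apply: minor_ideal_edge.
- by move=> d w ->; case: (gsub_hpart vb iE).
- exact: kreg_le r2' (kreg_minor_ideal vb covb).
- exact: (kreg_reg_le iE (@edge_ideal_graded K U leU G) vb covb H).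
Qed.

Lemma reg_join_le r : (2 <= r)%N -> (reg J1 <= r.+1%:Z%:E)%E -> (reg J2 <= r.+1%:Z%:E)%E ->
  (reg J <= r.+1%:Z%:E)%E.
Proof.
move=> r2' H1 H2.
have iP := minor_ideal_ideal K V.
have gP : gsub a (hpart (@minor_ideal K V)) by apply: gsub_hpart.
have gQ : gsub a (hpart mid_ideal) by apply: gsub_hpart mid_ideal_ideal.
have gJ : gsub a (hpart J) by apply: gsub_hpart.
have gJ1 : gsub a1 (hpart J1) by apply: gsub_hpart (edge_ideal_ideal _ _ _).
have gJ2 : gsub a2 (hpart J2) by apply: gsub_hpart (edge_ideal_ideal _ _ _).
have PQ : kreg a l (hpart (@minor_ideal K V)) (hpart mid_ideal) r.
  refine (@kreg_pull _ S _ S^o {mpoly K[#|V1| + #|V1|]}^o a a1 r1 _ _ _ _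
    (hpart (@minor_ideal K V1)) (hpart J1) gP gJ1 _ _ _ _ l r
    (kreg_minor_mod_edge va1 cov1 r2' H1)).
  - by move=> p q; rewrite rmorphB.
  - by move=> x p; rewrite rmorphM.
  - by move=> d p [Pp hp]; split; [case: (restr_minor_ideal Pp)|apply: hshift_restr].
  - by move=> d p [[Pp Jp] hp]; split=> //; apply: hshift_restr.
  - by move=> d p [Pp hp] [Jp _]; split.
  - move=> d p [Pp hp]; exists (x1 p); split.
      by split; [apply: extend_minor_ideal|apply: hshift_extend].
    by rewrite (restrK inj1) subrr; case: gJ1.
have QJ : kreg a l (hpart mid_ideal) (hpart J) r.
  refine (@kreg_pull _ S _ S^o {mpoly K[#|V2| + #|V2|]}^o a a2 r2 _ _ _ _
    (hpart (@minor_ideal K V2)) (hpart J2) gQ gJ2 _ _ _ _ l r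
    (kreg_minor_mod_edge va2 cov2 r2' H2)).
  - by move=> p q; rewrite rmorphB.
  - by move=> x p; rewrite rmorphM.
  - by move=> d p [[Pp _] hp]; split; [case: (restr_minor_ideal Pp)|apply: hshift_restr].
  - by move=> d p [Jp hp]; split; [case: (restr_join_ideal Jp)|apply: hshift_restr].
  - by move=> d p [[Pp Jp] hp] [Jp2 _]; split=> //; apply: join_ideal_restr.
  (* The lift stays in the middle ideal because its restriction to the first side vanishes. *)
  - move=> d p [Pp hp]; exists (x2 p); split.
      split; last exact: hshift_extend.
      split; first exact: extend_minor_ideal.
      by rewrite restr1_extend2 //; case: (edge_ideal_ideal K le1 G1).
    by rewrite (restrK inj2) subrr; case: gJ2.
apply: (reg_le_kreg iJ va cov).
apply: (@kreg_sub _ _ _ _ _ (hpart (@minor_ideal K V))) => //.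
- by move=> d p [Jp hp]; split=> //; apply: join_ideal_minor.
- by move=> d p ->; case: gJ.
- apply: kreg_trans PQ QJ => //.
    by move=> d p [[Pp _] hp].
  by move=> d p [Jp hp]; split=> //; apply: join_ideal_mid.
- by apply: kreg_le (kreg_minor_ideal va cov); lia.
Qed.

Lemma reg_complete_le : (forall v w : V, v != w -> adj (graph_join G1 G2) v w) ->
  (reg J <= 2%:Z%:E)%E.
Proof.
move=> complete; apply: (reg_le_kreg iJ va cov).
apply: kreg_ext (kreg_minor_ideal va cov) => // d p.
split=> -[Hp hp]; split=> //; last exact: join_ideal_minor.
move: p Hp {hp}; apply: minor_ideal_min => // v w /complete.
exact: join_edge.
Qed.
End Join.

Theorem mainTheorem8 (K : fieldType) (V1 V2 : finType)
    (G1 : sgraph V1) (G2 : sgraph V2)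
    (le1 : rel V1) (le2 : rel V2) (le12 : rel (V1 + V2)%type)
    (V1_nonempty : (0 < #|V1|)%N) (V2_nonempty : (0 < #|V2|)%N)
    (ord1 : total_order le1) (ord2 : total_order le2)
    (ord12 : total_order le12)
    (reg1 : (reg (binomial_edge_ideal K le1 G1)
             <= (num_max_cliques G1 + 1)%:Z%:E)%E)
    (reg2 : (reg (binomial_edge_ideal K le2 G2)
             <= (num_max_cliques G2 + 1)%:Z%:E)%E) :
  (reg (binomial_edge_ideal K le12 (graph_join G1 G2))
   <= (num_max_cliques (graph_join G1 G2) + 1)%:Z%:E)%E.
Proof.
have [c1 c2] := num_max_cliques_join G1 G2.
have c_gt0 := num_max_cliques_gt0 (graph_join G1 G2).
have [c_gt1|c_le1] := ltnP 1 (num_max_cliques (graph_join G1 G2)).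
  (* Here [r] is the number of maximal cliques of the join, which is at least 2 and bounds those of
     [G1] and [G2]. *)
  rewrite addn1; apply: (reg_join_le ord1 ord2 ord12) => //.
    by apply: le_trans reg1 _; rewrite lee_fin; lia.
  by apply: le_trans reg2 _; rewrite lee_fin; lia.
(* A single maximal clique leaves the bound 2, too small for [reg_join_le] but exact enough for a
   complete join. *)
apply: le_trans (reg_complete_le (le12 := le12) K ord12 (one_max_clique c_le1)) _.
by rewrite lee_fin; lia.
Qed.
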